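(* Let $n$ be a positive integer. The joint distribution of the statistics $\mu$ and $\mathrm{inv}$ on the set $\mathrm{ASM}(n)$ is the same as the joint distribution of the statistics $\mu_{\nabla}$ and $\mathrm{inv}_{\nabla}$ on the set $\mathrm{AST}(n)$, i.e., for all integers $m$ and $i$, $$|\{A \in \mathrm{ASM}(n) : \mu(A)=m,\ \mathrm{inv}(A)=i\}| = |\{T \in \mathrm{AST}(n) : \mu_{\nabla}(T)=m,\ \mathrm{inv}_{\nabla}(T)=i \}|.$$
   Context: $\mathrm{ASM}(n)$ is the set of alternating sign matrices of order $n$: $n\times n$ matrices with entries in $\{0,1,-1\}$ such that along each row and each column the non-zero entries alternate in sign and add up to $1$. For $A=(a_{i,j})\in\mathrm{ASM}(n)$, $\mu(A)$ is the number of $-1$'s in $A$, and the inversion number is $$\mathrm{inv}(A)=\sum_{1\le i'<i\le n,\ 1\le j'\le j\le n} a_{i',j}\,a_{i,j'}.$$ An alternating sign triangle (AST) of order $n$ is a triangular array $T=(t_{i,j})_{1\le i\le n,\ i\le j\le 2n-i}$ with entries in $\{0,1,-1\}$ (row $1$ is the top row) such that: the non-zero entries alternate in sign in each row and each column; all row sums are $1$; the topmost non-zero entry of each column, if it exists, is $1$. $\mathrm{AST}(n)$ is the set of all ASTs of order $n$. For $T\in\mathrm{AST}(n)$, $\mu_\nabla(T)$ is the number of $-1$'s in $T$, and $$\mathrm{inv}_\nabla(T)=\tfrac12\left(\#\mathrm{SW}(T)+\#\mathrm{NE}(T)\right),$$ where $\mathrm{SW}(T)$ is the set of positions $(i,j)$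 with $t_{i,j}=0$, $\sum_{i'<i}t_{i',j}=1$ and $\sum_{j'\le j}t_{i,j'}=1$, and $\mathrm{NE}(T)$ is the set of positions $(i,j)$ with $t_{i,j}=0$, $\sum_{i'<i}t_{i',j}=0$ and $\sum_{j'\le j}t_{i,j'}=0$ (sums over positions $(i',j)$ resp. $(i,j')$ belonging to the array). (In the six-vertex picture these are the vertices with both vertical edges pointing down and both horizontal edges pointing left, respectively both vertical edges pointing up and both horizontal edges pointing right.) *)

(* Defs.v *)
From HB Require Import structures.
From mathcomp Require Import all_boot all_order all_algebra.

Set Implicit Arguments.
Unset Strict Implicit.
Unset Printing Implicit Defensive.

Import Order.TTheory GRing.Theory Num.Theory.
Local Open Scope ring_scope.

(* {0, 1, -1} as a finite subtype of int, so that the arrays below form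
   finite types. *)
Definition entry : Type := seq_sub [:: 0; 1; -1 : int].
HB.instance Definition _ := Finite.on entry.

Definition entry_val (x : entry) : int := ssval x.
Coercion entry_val : entry >-> int.

Definition nonzeros (s : seq int) : seq int := [seq x <- s | x != 0].

Definition alternating (s : seq int) : bool :=
  sorted (fun x y => x * y < 0) (nonzeros s).

Definition is_ASM n (A : 'M[entry]_n) : bool :=
  [forall i, alternating [seq (A i j : int) | j : 'I_n]
             && (\sum_j (A i j : int) == 1)]
  && [forall j, alternating [seq (A i j : int) | i : 'I_n]
                && (\sum_i (A i j : int) == 1)].

Definition ASM n : {set 'M[entry]_n} := [set A | is_ASM A].

Definition mu_ASM n (A : 'M[entry]_n) : nat :=
  #|[set p : 'I_n * 'I_n | (A p.1 p.2 : int) == -1]|.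

Definition inv_ASM n (A : 'M[entry]_n) : int :=
  \sum_(i < n) \sum_(i' < n | (i' < i)%N) \sum_(j < n) \sum_(j' < n | (j' <= j)%N)
    (A i' j : int) * (A i j' : int).

(* Indices start at 0: the array condition 1 <= i <= n, i <= j <= 2n - i
   becomes i < n, i <= j, i + j < 2n - 1 after shifting both indices by one. *)
Definition position n : finType :=
  {p : 'I_n * 'I_(n.*2.-1) | (p.1 <= p.2)%N && (p.1 + p.2 < n.*2.-1)%N}.

Definition row_of n (p : position n) : 'I_n := (val p).1.
Definition col_of n (p : position n) : 'I_(n.*2.-1) := (val p).2.

Notation triangle n := {ffun position n -> entry}.

(* [pmap insub] discards the index pairs lying outside the array. *)
Definition row_entries n (T : triangle n) (i : 'I_n) : seq int :=
  [seq (T p : int) | p <- pmap insub [seq (i, j) | j : 'I_(n.*2.-1)]].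

Definition col_entries n (T : triangle n) (j : 'I_(n.*2.-1)) : seq int :=
  [seq (T p : int) | p <- pmap insub [seq (i, j) | i : 'I_n]].

Definition is_AST n (T : triangle n) : bool :=
  [&& [forall i, alternating (row_entries T i)],
      [forall j, alternating (col_entries T j)],
      [forall i, \sum_(x <- row_entries T i) x == 1] &
      [forall j, if ohead (nonzeros (col_entries T j)) is Some x
                 then x == 1 else true]].

Definition AST n : {set triangle n} := [set T | is_AST T].

Definition mu_nabla n (T : triangle n) : nat :=
  #|[set p : position n | (T p : int) == -1]|.

Definition sum_above n (T : triangle n) (p : position n) : int :=
  \sum_(q : position n | (col_of q == col_of p) && (row_of q < row_of p)%N)
    (T q : int).

Definition sum_left n (T : triangle n) (p : position n) : int :=
  \sum_(q : position n | (row_of q == row_of p) && (col_of q <= col_of p)%N)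
    (T q : int).

Definition SW n (T : triangle n) : {set position n} :=
  [set p | [&& (T p : int) == 0, sum_above T p == 1 & sum_left T p == 1]].

Definition NE n (T : triangle n) : {set position n} :=
  [set p | [&& (T p : int) == 0, sum_above T p == 0 & sum_left T p == 0]].

(* Rational-valued, so that the factor 1/2 involves no truncation. *)
Definition inv_nabla n (T : triangle n) : rat :=
  (#|SW T| + #|NE T|)%N%:R / 2%:R.

(* Main.v *)
Require Import Defs.
From mathcomp Require Import all_boot all_order all_algebra.
From mathcomp Require Import all_field ring zify.

Set Implicit Arguments.
Unset Strict Implicit.
Unset Printing Implicit Defensive.

Import Order.TTheory GRing.Theory Num.Theory.
Local Open Scope ring_scope.

(* Both sides are partition functions of the six-vertex model: a zero entry has
   weight a or b, a nonzero entry has weight c.  With s(x) = x - 1/x, let cell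
   (i, j) have weights s(q p), s(q / p) and s(q^2), where p is the product of a
   row and a column parameter.  In a triangle, row i, column i and column
   2n - i share the parameter u_i (they form one line that is reflected twice),
   and the central column has parameter w.  With suitable weights on the two
   slanted sides, the sum over triangles F(u_1, ..., u_(n-1); w) is equal to the
   domain wall sum D over matrices whose rows and columns both have parameters
   u_1, ..., u_(n-1), w.

   F is symmetric in the u_i by the Yang-Baxter and reflection equations, and so
   is D.  In x = u_(n-1), both are Laurent polynomials of degree at most 2n - 1;
   they agree at the 4n points x = +- q / u_j, x = +- 1 / (q u_j), x^4 = q^2 and
   x^4 = 1 / q^2, because there the outer one or two lines are frozen and both
   sides reduce, with the same factor, to n - 1 or n - 2.

   For u_1 = ... = w the slanted sides carry the ordinary weights, so that the
   generating functions of (number of -1's, number of cells of weight b)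
   coincide.  For a matrix the second statistic is 2 inv, for a triangle it is
   #SW + #NE. *)

(** * Vertices, Yang-Baxter and reflection equations *)

(** A vertex passes the updated sums on to an arbitrary continuation [f]. Each local relation thus
    becomes an identity of linear operators, and crossings of lines move through the lattice by
    rewriting.

    The number of points leaves little room. Multiplied by x^(2n-1), the difference of the two sides
    is a polynomial of degree at most 4n - 2. The weights alone only suggest the Laurent degree 2n,
    for which 4n points would not suffice. One degree is saved on the matrix side because every row
    contains a 1, and on the triangle side because leading terms cancel.

    The proof of symmetry ends with the cancellation of a crossing factor, whence q^8 <> 1. As the
    4n points have to be distinct, the identity is obtained for generic parameters before it is
    extended to all. *)

Section SixVertex.
Variable K : fieldType.

(* [v] and [h] are the partial sums, in {0, 1}, of the column above a cell and of
   the row to its left; the continuation [f] receives the sums that include the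
   cell.  The entry is nonzero exactly when both sums are flipped. *)
Definition vert (a b c : K) (v h : bool) (f : bool -> bool -> K) : K :=
  if v == h then b * f v h + c * f (~~ v) (~~ h) else a * f v h.

(* Two parallel lines with partial sums [v1] and [v2] cross. *)
Definition cross (al be ga : K) (v1 v2 : bool) (f : bool -> bool -> K) : K :=
  if v1 == v2 then al * f v1 v2 else be * f v1 v2 + ga * f v2 v1.

Lemma vert_ext a b c v h f g :
  (forall v h, f v h = g v h) -> vert a b c v h f = vert a b c v h g.
Proof. by move=> fg; rewrite /vert !fg. Qed.

Lemma cross_ext al be ga v1 v2 f g :
  (forall v h, f v h = g v h) -> cross al be ga v1 v2 f = cross al be ga v1 v2 g.
Proof. by move=> fg; rewrite /cross !fg. Qed.

Lemma vert_lin a b c v h k1 k2 f g :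
  vert a b c v h (fun v h => k1 * f v h + k2 * g v h) =
  k1 * vert a b c v h f + k2 * vert a b c v h g.
Proof. by rewrite /vert; case: ifP => _; ring. Qed.

Lemma vert_scale a b c v h f k :
  vert a b c v h f * k = vert a b c v h (fun v h => f v h * k).
Proof. by rewrite /vert; case: ifP => _; ring. Qed.

Definition sg (x : K) := x - x^-1.

Variable q : K.
Hypothesis q0 : q != 0.

Definition weight_a p := sg (q * p).
Notation wa := weight_a.
Definition weight_b p := sg (q / p).
Notation wb := weight_b.
Definition weight_c := sg (q ^+ 2).
Notation wc := weight_c.
Definition vertex p := vert (wa p) (wb p) wc.
Notation vtx := vertex.
(** The R-matrix of the six-vertex model. On two equal sums it is the scalar [sg (q ^+ 2 * x / y)],
    which is why it disappears at boundaries with constant sums. *)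
Definition Rcross x y := cross (sg (q ^+ 2 * x / y)) wc (sg (y / x)).
Notation R := Rcross.

Lemma vertex_ext p v h f g : (forall v h, f v h = g v h) -> vtx p v h f = vtx p v h g.
Proof. exact: vert_ext. Qed.

Lemma vertex_scalel p v h f k : k * vtx p v h f = vtx p v h (fun v h => k * f v h).
Proof. by rewrite /vtx /vert; case: ifP => _; ring. Qed.

Lemma Rcross_ext x y v1 v2 f g : (forall v h, f v h = g v h) -> R x y v1 v2 f = R x y v1 v2 g.
Proof. exact: cross_ext. Qed.

Lemma Rcross_vertex x y p v h v1 v2 g :
  R x y v1 v2 (fun v1 v2 => vtx p v h (g v1 v2)) =
  vtx p v h (fun v h => R x y v1 v2 (fun v1 v2 => g v1 v2 v h)).
Proof. by rewrite /R /vtx /vert /cross; do !case: eqP => _; ring. Qed.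

(** The Yang-Baxter equation for two rows and a column. The arbitrary [g] covers all outgoing sums
    at once, so that eight rational identities remain, one for each choice of incoming sums. *)
Lemma ybe_row x y p v h1 h2 (g : bool -> bool -> bool -> K) :
  x != 0 -> y != 0 -> p != 0 ->
  R x y h1 h2 (fun h1 h2 => vtx (x * p) v h1 (fun v h1 => vtx (y * p) v h2 (fun v h2 => g v h1 h2))) =
  vtx (y * p) v h1 (fun v h1 => vtx (x * p) v h2 (fun v h2 => R x y h1 h2 (g v))).
Proof.
move=> x0 y0 p0; case: v h1 h2 => [] [] []; rewrite /R /vtx /vert /cross /= /wa /wb /wc /sg.
all: by field; rewrite ?x0 ?y0 ?p0 ?q0.
Qed.

Lemma ybe_col x y p h v1 v2 (g : bool -> bool -> bool -> K) :
  x != 0 -> y != 0 -> p != 0 ->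
  R x y v1 v2 (fun v1 v2 => vtx (p * x) v1 h (fun v1 h => vtx (p * y) v2 h (fun v2 h => g h v1 v2))) =
  vtx (p * y) v1 h (fun v1 h => vtx (p * x) v2 h (fun v2 h => R x y v1 v2 (g h))).
Proof.
move=> x0 y0 p0; case: h v1 v2 => [] [] []; rewrite /R /vtx /vert /cross /= /wa /wb /wc /sg.
all: by field; rewrite ?x0 ?y0 ?p0 ?q0.
Qed.

(** * Reflection at the slanted sides of the triangle *)

Variable w : K.
Hypothesis w0 : w != 0.

(* Triangular solutions of the reflection equation.  For [u = w] they are the
   weights of a cell with row sum 0 to its left and an unrestricted column sum,
   respectively of a cell that completes its row sum to 1. *)
Definition corner_left u (v : bool) (f : bool -> K) : K :=
  if v then wa (u * w) * f false
  else wb (u ^+ 2) * f false + sg (q ^+ 2 * w / u) * f true.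
Notation cornerL := corner_left.

Definition corner_right u (v h : bool) : K :=
  if h then (if v then wb (u * w) else wa (u ^+ 2))
  else (if v then 0 else sg (q ^+ 2 * u / w)).
Notation cornerR := corner_right.

Lemma corner_left_ext u v f g : (forall h, f h = g h) -> cornerL u v f = cornerL u v g.
Proof. by move=> fg; rewrite /cornerL !fg. Qed.

Lemma corner_left_vertex u v p v' h g :
  cornerL u v (fun k => vtx p v' h (g k)) = vtx p v' h (fun v' h => cornerL u v (fun k => g k v' h)).
Proof. by rewrite /cornerL /vtx /vert; case: v; case: ifP => _; ring. Qed.

Lemma corner_left_Rcross u v x y v1 v2 g :
  cornerL u v (fun k => R x y v1 v2 (g k)) = R x y v1 v2 (fun v1 v2 => cornerL u v (fun k => g k v1 v2)).
Proof. by rewrite /cornerL /R /cross; case: v; case: ifP => _; ring. Qed.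

Lemma corner_left_scale u v f k : k * cornerL u v f = cornerL u v (fun h => k * f h).
Proof. by rewrite /cornerL; case: v; ring. Qed.

Lemma Rcross_scale x y v1 v2 f k : R x y v1 v2 f * k = R x y v1 v2 (fun v1 v2 => f v1 v2 * k).
Proof. by rewrite /R /cross; case: ifP => _; ring. Qed.

(** The left reflection equation: the two lines come in as columns and leave as rows, so a crossing
    of columns is traded for a crossing of rows. *)
Lemma reflectL x y l1 l2 g : x != 0 -> y != 0 ->
  R x y l1 l2 (fun l1 l2 => cornerL x l1 (fun k => vtx (x * y) l2 k (fun m h1 => cornerL y m (g h1)))) =
  cornerL y l1 (fun k => vtx (y * x) l2 k (fun m h1 => cornerL x m (fun h2 => R x y h1 h2 g))).
Proof.
move=> x0 y0; case: l1 l2 => [] []; rewrite /R /cornerL /vtx /vert /cross /= /wa /wb /wc /sg.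
all: by field; rewrite ?x0 ?y0 ?w0 ?q0.
Qed.

(** The right reflection equation trades the crossing of rows for one of the right columns. Row and
    column both end at a right corner, which is therefore a scalar. *)
Lemma reflectR x y r1 r2 h1 h2 : x != 0 -> y != 0 ->
  R x y h1 h2 (fun h1 h2 => vtx (x * y) r2 h1 (fun m h1 => cornerR x r1 h1 * cornerR y m h2)) =
  R x y r1 r2 (fun r1 r2 => vtx (y * x) r2 h1 (fun m h1 => cornerR y r1 h1 * cornerR x m h2)).
Proof.
move=> x0 y0; case: r1 r2 h1 h2 => [] [] [] []; rewrite /R /cornerR /vtx /vert /cross /= /wa /wb /wc /sg.
all: by field; rewrite ?x0 ?y0 ?w0 ?q0.
Qed.

(* The columns are listed from the outside in: each pair holds the sums of the
   left and the right column of one line, [vm] that of the central column.  A row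
   is thus read inwards on its left half and outwards on its right half. *)
Fixpoint ast_row x us h vm s (f : bool -> bool -> seq (bool * bool) -> K) : K :=
  match us, s with
  | [::], [::] => vtx (x * w) vm h (fun v h => f h v [::])
  | u :: us, (l, r) :: s =>
      vtx (x * u) l h (fun l h => ast_row x us h vm s (fun h v o =>
        vtx (x * u) r h (fun r h => f h v ((l, r) :: o))))
  | _, _ => 0
  end.
Notation rowS := ast_row.

(** Once the lines are used up, the bottom cell is left. It has to bring its row sum from 0 to 1,
    hence is a 1 below a column sum 0. *)
Fixpoint ast_state us vm s : K :=
  match us, s with
  | [::], [::] => if vm then 0 else wc
  | u :: us, (l, r) :: s =>
      cornerL u l (fun h => rowS u us h vm s (fun h v o => cornerR u r h * ast_state us v o))
  | _, _ => 0
  end.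
Notation Z := ast_state.

Lemma ast_row_ext x us h vm s f g :
  (forall h v o, size o = size us -> f h v o = g h v o) ->
  rowS x us h vm s f = rowS x us h vm s g.
Proof.
elim: us h s f g => [|u us IH] h [|[l r] s] f g fg //=; apply: vert_ext => v1 h1.
  exact: fg.
by apply: IH => h2 v2 o so; apply: vert_ext => v3 h3; apply: fg; rewrite /= so.
Qed.

Lemma ast_row_lin x us h vm s k1 k2 f g :
  rowS x us h vm s (fun h v o => k1 * f h v o + k2 * g h v o) =
  k1 * rowS x us h vm s f + k2 * rowS x us h vm s g.
Proof.
elim: us h s f g => [|u us IH] h [|[l r] s] f g //=; try by rewrite !mulr0 addr0.
  exact: vert_lin.
rewrite -vert_lin; apply: vert_ext => v1 h1; rewrite -IH.
by apply: ast_row_ext => h2 v2 o _; apply: vert_lin.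
Qed.

Lemma ast_row_scale x us h vm s k f :
  rowS x us h vm s (fun h v o => k * f h v o) = k * rowS x us h vm s f.
Proof.
have := ast_row_lin x us h vm s k 0 f (fun _ _ _ => 0); rewrite [0 * rowS _ _ _ _ _ _]mul0r addr0 => <-.
by apply: ast_row_ext => *; rewrite mul0r addr0.
Qed.

Lemma Rcross_ast_row x y p us h vm s v1 v2 g :
  R x y v1 v2 (fun v1 v2 => rowS p us h vm s (g v1 v2)) =
  rowS p us h vm s (fun h v o => R x y v1 v2 (fun v1 v2 => g v1 v2 h v o)).
Proof.
rewrite /R /cross; case: eqP => _; first by rewrite ast_row_scale.
by rewrite ast_row_lin.
Qed.

Lemma corner_left_ast_row u v p us h vm s g :
  cornerL u v (fun k => rowS p us h vm s (g k)) =
  rowS p us h vm s (fun h v' o => cornerL u v (fun k => g k h v' o)).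
Proof.
rewrite /cornerL; case: v => /=; first by rewrite ast_row_scale.
by rewrite ast_row_lin.
Qed.

Notation nz us := (all (fun u : K => u != 0) us).


Lemma vertex_ast_row p v h x us h' vm s g :
  vtx p v h (fun v h => rowS x us h' vm s (g v h)) =
  rowS x us h' vm s (fun h' vm o => vtx p v h (fun v h => g v h h' vm o)).
Proof.
rewrite /vtx /vert; case: ifP => _; last by rewrite ast_row_scale.
by rewrite ast_row_lin.
Qed.

Lemma vertexC p v h p' v' h' (g : bool -> bool -> bool -> bool -> K) :
  vtx p v h (fun v h => vtx p' v' h' (g v h)) =
  vtx p' v' h' (fun v' h' => vtx p v h (fun v h => g v h v' h')).
Proof. by rewrite /vtx /vert; do 2!case: ifP => _; ring. Qed.

Definition ast_row2 x y us h1 h2 vm s (g : bool -> bool -> bool -> seq (bool * bool) -> K) :=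
  rowS x us h1 vm s (fun h1 v o => rowS y us h2 v o (g h1)).
Notation rowS2 := ast_row2.

(** Vertices on disjoint edges commute, so two rows can be evaluated together, column by column, as
    the Yang-Baxter equation requires. *)
Lemma ast_row2_cons x y u us h1 h2 vm l r s g :
  rowS2 x y (u :: us) h1 h2 vm ((l, r) :: s) g =
  vtx (x * u) l h1 (fun l h1 => vtx (y * u) l h2 (fun l h2 =>
    rowS2 x y us h1 h2 vm s (fun h1 h2 v o =>
      vtx (x * u) r h1 (fun r h1 => vtx (y * u) r h2 (fun r h2 =>
        g h1 h2 v ((l, r) :: o)))))).
Proof.
apply: vert_ext => l1 k1; rewrite vertex_ast_row; apply: ast_row_ext => k2 v2 o _ /=.
rewrite vertexC; apply: vert_ext => l2 k3; rewrite vertex_ast_row.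
by apply: ast_row_ext.
Qed.

Lemma ast_row2_ext x y us h1 h2 vm s f g :
  (forall h1 h2 v o, size o = size us -> f h1 h2 v o = g h1 h2 v o) ->
  rowS2 x y us h1 h2 vm s f = rowS2 x y us h1 h2 vm s g.
Proof.
move=> fg; apply: ast_row_ext => k v o so; apply: ast_row_ext => k' v' o' so'.
exact: fg.
Qed.

Lemma ybe_ast_row x y us h1 h2 vm s g : x != 0 -> y != 0 -> nz us ->
  R x y h1 h2 (fun h1 h2 => rowS2 x y us h1 h2 vm s g) =
  rowS2 y x us h1 h2 vm s (fun h1 h2 v o => R x y h1 h2 (fun h1 h2 => g h1 h2 v o)).
Proof.
move=> x0 y0; elim: us h1 h2 s g => [|u us IH] h1 h2 [|[l r] s] g.
- by move=> _; exact: (ybe_row _ _ _ (fun v h1 h2 => g h1 h2 v [::])).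
- by move=> _; rewrite /rowS2 /R /cross /=; case: eqP; rewrite !mulr0 ?addr0.
- by move=> _; rewrite /rowS2 /R /cross /=; case: eqP; rewrite !mulr0 ?addr0.
case/andP=> u0 nus; rewrite ast_row2_cons.
under Rcross_ext do rewrite ast_row2_cons.
rewrite (ybe_row _ _ _ (fun l h1 h2 => rowS2 x y us h1 h2 vm s _)) //.
apply: vert_ext => l1 k1; apply: vert_ext => l2 k2; rewrite IH //.
apply: ast_row2_ext => k3 k4 v o _.
by rewrite (ybe_row _ _ _ (fun r h1 h2 => g h1 h2 v ((l2, r) :: o))).
Qed.

Lemma Rcross_ast_row2 x y p p' us h h' vm s v1 v2 g :
  R x y v1 v2 (fun v1 v2 => rowS2 p p' us h h' vm s (g v1 v2)) =
  rowS2 p p' us h h' vm s (fun h h' v o => R x y v1 v2 (fun v1 v2 => g v1 v2 h h' v o)).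
Proof. by rewrite /rowS2 Rcross_ast_row; apply: ast_row_ext => k v o _; rewrite Rcross_ast_row. Qed.

Lemma ast_row_vertex_scale p p' us h h' vm s r (F : bool -> bool -> bool -> K) G :
  rowS p us h' vm s (fun k v o => vtx p' r h (F k) * G k v o) =
  vtx p' r h (fun m h1 => rowS p us h' vm s (fun k v o => F k m h1 * G k v o)).
Proof. by rewrite vertex_ast_row; apply: ast_row_ext => *; exact: vert_scale. Qed.

(** The left corner of the second row depends on the first row only through one column sum, and can
    be evaluated before the rest of that row. The two rows then begin as in [reflectL] and end as in
    [reflectR]. *)
Lemma ast_state_cons2 x y us vm l1 r1 l2 r2 s :
  Z (x :: y :: us) vm ((l1, r1) :: (l2, r2) :: s) =
  cornerL x l1 (fun k => vtx (x * y) l2 k (fun m h1 => cornerL y m (fun h2 =>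
    rowS2 x y us h1 h2 vm s (fun h1 h2 v o =>
      vtx (x * y) r2 h1 (fun m h1 => cornerR x r1 h1 * cornerR y m h2) * Z us v o)))).
Proof.
apply: corner_left_ext => k; apply: vert_ext => m h1.
rewrite corner_left_ast_row; apply: ast_row_ext => h v o _.
under [RHS]corner_left_ext do rewrite ast_row_vertex_scale.
rewrite corner_left_vertex; apply: vert_ext => r h'; rewrite corner_left_scale.
apply: corner_left_ext => h2; rewrite -ast_row_scale; apply: ast_row_ext => h3 v3 o3 _.
by rewrite mulrA.
Qed.

(** A crossing above the two left columns passes the left reflection, runs along both rows, passes
    the right reflection and ends above the two right columns. *)
Lemma ast_state_swap x y us vm l1 r1 l2 r2 s : x != 0 -> y != 0 -> nz us ->
  R x y l1 l2 (fun l1 l2 => Z (x :: y :: us) vm ((l1, r1) :: (l2, r2) :: s)) =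
  R x y r1 r2 (fun r1 r2 => Z (y :: x :: us) vm ((l1, r1) :: (l2, r2) :: s)).
Proof.
move=> x0 y0 nus; under Rcross_ext do rewrite ast_state_cons2.
rewrite (reflectL _ _ (fun h1 h2 => rowS2 x y us h1 h2 vm s _)) //.
under [RHS]Rcross_ext do rewrite ast_state_cons2.
rewrite -[RHS]corner_left_Rcross; apply: corner_left_ext => k.
rewrite [RHS]Rcross_vertex; apply: vertex_ext => m h1.
rewrite -[RHS]corner_left_Rcross; apply: corner_left_ext => h2.
rewrite ybe_ast_row // Rcross_ast_row2; apply: ast_row2_ext => k1 k2 v o _.
by rewrite -!Rcross_scale reflectR.
Qed.
Lemma Rcross_sym x y v1 v2 f : R x y v1 v2 f = R x y v2 v1 (fun v2 v1 => f v1 v2).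
Proof. by rewrite /R /cross [v2 == v1]eq_sym; case: eqP => // ->. Qed.

(** On both sides the crossing descends through the row, and the relation assumed below the row
    finishes the proof. The right columns are met from the inside out, in the opposite order, which
    explains [Rcross_sym]. *)
Lemma ast_row_swap p x y us h vm l1 r1 l2 r2 s pre P G12 G21 :
  p != 0 -> x != 0 -> y != 0 -> size P = size pre ->
  (forall h v P l1 r1 l2 r2 o, size P = size pre ->
     R x y l1 l2 (fun l1 l2 => G12 h v (P ++ [:: (l1, r1), (l2, r2) & o])) =
     R x y r1 r2 (fun r1 r2 => G21 h v (P ++ [:: (l1, r1), (l2, r2) & o]))) ->
  R x y l1 l2 (fun l1 l2 => rowS p (pre ++ [:: x, y & us]) h vm (P ++ [:: (l1, r1), (l2, r2) & s]) G12) =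
  R x y r1 r2 (fun r1 r2 => rowS p (pre ++ [:: y, x & us]) h vm (P ++ [:: (l1, r1), (l2, r2) & s]) G21).
Proof.
move=> p0 x0 y0; elim: pre P h l1 r1 l2 r2 s G12 G21 => [|u pre IH] [|[l r] P] h l1 r1 l2 r2 s G12 G21 //=.
  move=> _ G1221; rewrite (ybe_col _ _ _ (fun h l1 l2 => rowS p us h vm s _)) //.
  rewrite [RHS]Rcross_vertex; apply: vertex_ext => l1' h1; rewrite [RHS]Rcross_vertex; apply: vertex_ext => l2' h2.
  rewrite [LHS]Rcross_ast_row [RHS]Rcross_ast_row; apply: ast_row_ext => h3 v o _.
  rewrite [LHS]Rcross_vertex [RHS]Rcross_sym (ybe_col _ _ _ (fun h r2 r1 => G21 h v [:: (l1', r1), (l2', r2) & o])) //.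
  apply: vertex_ext => r2' h4; rewrite [LHS]Rcross_vertex; apply: vertex_ext => r1' h5.
  by rewrite -[RHS]Rcross_sym; exact: (G1221 h5 v [::]).
move=> [sP] G1221; rewrite [LHS]Rcross_vertex [RHS]Rcross_vertex; apply: vertex_ext => l' h1.
apply: IH => // h2 v P' l1' r1' l2' r2' o sP'.
rewrite [LHS]Rcross_vertex [RHS]Rcross_vertex; apply: vertex_ext => r' h3.
by apply: (G1221 h3 v ((l', r') :: P')); rewrite /= sP'.
Qed.

Lemma Rcross_corner_left u v x y v1 v2 g :
  R x y v1 v2 (fun v1 v2 => cornerL u v (g v1 v2)) = cornerL u v (fun k => R x y v1 v2 (fun v1 v2 => g v1 v2 k)).
Proof. by rewrite corner_left_Rcross. Qed.

Lemma Rcross_scalel x y v1 v2 f k : R x y v1 v2 (fun v1 v2 => k * f v1 v2) = k * R x y v1 v2 f.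
Proof. by rewrite mulrC Rcross_scale; apply: Rcross_ext => *; rewrite mulrC. Qed.

Lemma ast_state_swap_at x y us pre vm l1 r1 l2 r2 s P :
  x != 0 -> y != 0 -> nz us -> nz pre -> size P = size pre ->
  R x y l1 l2 (fun l1 l2 => Z (pre ++ [:: x, y & us]) vm (P ++ [:: (l1, r1), (l2, r2) & s])) =
  R x y r1 r2 (fun r1 r2 => Z (pre ++ [:: y, x & us]) vm (P ++ [:: (l1, r1), (l2, r2) & s])).
Proof.
move=> x0 y0 nus; elim: pre P vm l1 r1 l2 r2 s => [|u pre IH] [|[l r] P] vm l1 r1 l2 r2 s //=.
  by move=> _ _; exact: ast_state_swap.
case/andP=> u0 npre [sP]; rewrite [LHS]Rcross_corner_left [RHS]Rcross_corner_left; apply: corner_left_ext => k.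
apply: ast_row_swap => // h v P' l1' r1' l2' r2' o sP'.
by rewrite [LHS]Rcross_scalel [RHS]Rcross_scalel IH.
Qed.

Definition ast_fun us := Z us false (nseq (size us) (false, false)).
Notation F := ast_fun.

(* The factor that comes from the crossing of two lines cannot vanish for both
   orders of the lines. *)
Lemma swap_cancel (g : K -> K -> K) x y : x != 0 -> y != 0 -> q ^+ 8 != 1 ->
  (forall x y, x != 0 -> y != 0 -> sg (q ^+ 2 * x / y) * g x y = sg (q ^+ 2 * x / y) * g y x) ->
  g x y = g y x.
Proof.
move=> x0 y0 q8 H; have H1 := H _ _ x0 y0; have H2 := H _ _ y0 x0.
have sgP a b : a != 0 -> b != 0 -> (sg (q ^+ 2 * a / b) == 0) = (q ^+ 4 * a ^+ 2 == b ^+ 2).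
  move=> a0 b0; apply/eqP/eqP => E.
    have : sg (q ^+ 2 * a / b) * (q^+2 * a * b) = 0 by rewrite E mul0r.
    have -> : sg (q ^+ 2 * a / b) * (q^+2 * a * b) = q ^+ 4 * a ^+ 2 - b ^+ 2.
      by rewrite /sg; field; rewrite q0 a0 b0.
    by move/eqP; rewrite subr_eq0 => /eqP.
  have -> : sg (q ^+ 2 * a / b) = (q ^+ 4 * a ^+ 2 - b ^+ 2) / (q^+2 * a * b).
    by rewrite /sg; field; rewrite q0 a0 b0.
  by rewrite E subrr mul0r.
case: (eqVneq (sg (q ^+ 2 * x / y)) 0) => E1; last exact: (mulfI E1).
case: (eqVneq (sg (q ^+ 2 * y / x)) 0) => E2; last exact/esym/(mulfI E2).
move/eqP: E1; move/eqP: E2; rewrite !sgP // => /eqP E1 /eqP E2; case/negP: q8; apply/eqP.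
have y2 : y ^+ 2 != 0 by rewrite expf_neq0.
apply: (mulIf y2); rewrite mul1r -[in RHS]E2 -E1; ring.
Qed.

(** Above the triangle all column sums are 0, so the left and the right crossing are the same
    scalar, and [swap_cancel] removes it. *)
Lemma ast_fun_swap x y us pre : x != 0 -> y != 0 -> nz us -> nz pre -> q ^+ 8 != 1 ->
  F (pre ++ [:: x, y & us]) = F (pre ++ [:: y, x & us]).
Proof.
move=> x0 y0 nus npre q8.
apply: (swap_cancel (g := fun x y => F (pre ++ [:: x, y & us]))) => // a b a0 b0.
have := @ast_state_swap_at a b us pre false false false false false (nseq (size us) (false,false)) (nseq (size pre) (false,false)) a0 b0 nus npre (size_nseq _ _).
by rewrite /R /cross /= /F !size_cat !nseqD.
Qed.
End SixVertex.

(** * The domain wall partition function *)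

Section DomainWall.
Variables (K : fieldType) (q : K).
Hypotheses (q0 : q != 0) (q8 : q ^+ 8 != 1).
Notation vtx := (vertex q).
Notation R := (Rcross q).
Notation wa := (weight_a q).
Notation wb := (weight_b q).
Notation wc := (weight_c q).
Notation nz us := (all (fun u : K => u != 0) us).

Fixpoint dw_row x ys h s (f : bool -> seq bool -> K) : K :=
  match ys, s with
  | [::], [::] => f h [::]
  | y :: ys, v :: s => vtx (x * y) v h (fun v h => dw_row x ys h s (fun h o => f h (v :: o)))
  | _, _ => 0
  end.
Notation row := dw_row.

Fixpoint dw_state xs ys s : K :=
  match xs with
  | [::] => if all id s then 1 else 0
  | x :: xs => row x ys false s (fun h o => if h then dw_state xs ys o else 0)
  end.
Notation Zd := dw_state.

Definition dw_fun xs ys := Zd xs ys (nseq (size ys) false).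
Notation D := dw_fun.

Lemma dw_row_ext x ys h s f g :
  (forall h o, size o = size ys -> f h o = g h o) -> row x ys h s f = row x ys h s g.
Proof.
elim: ys h s f g => [|y ys IH] h [|v s] f g fg //=; first exact: fg.
by apply: vertex_ext => v1 h1; apply: IH => h2 o so; apply: fg; rewrite /= so.
Qed.

Lemma dw_row_lin x ys h s k1 k2 f g :
  row x ys h s (fun h o => k1 * f h o + k2 * g h o) = k1 * row x ys h s f + k2 * row x ys h s g.
Proof.
elim: ys h s f g => [|y ys IH] h [|v s] f g //=; try by rewrite !mulr0 addr0.
by rewrite -vert_lin; apply: vertex_ext => v1 h1; rewrite -IH.
Qed.

Lemma dw_row_scale x ys h s k f : row x ys h s (fun h o => k * f h o) = k * row x ys h s f.
Proof.
have := dw_row_lin x ys h s k 0 f (fun _ _ => 0); rewrite [0 * row _ _ _ _ _]mul0r addr0 => <-.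
by apply: dw_row_ext => *; rewrite mul0r addr0.
Qed.

Lemma dw_row_eq0 x ys h s f : (forall h o, size o = size ys -> f h o = 0) -> row x ys h s f = 0.
Proof.
move=> f0; rewrite -[RHS](mul0r (row x ys h s f)) -dw_row_scale.
by apply: dw_row_ext => h' o so; rewrite f0 // mul0r.
Qed.

Lemma vertex_dw_row p v h x ys h' s g :
  vtx p v h (fun v h => row x ys h' s (g v h)) =
  row x ys h' s (fun h' o => vtx p v h (fun v h => g v h h' o)).
Proof.
rewrite /vertex /vert; case: ifP => _; last by rewrite dw_row_scale.
by rewrite dw_row_lin.
Qed.

Definition dw_row2 x y ys h1 h2 s (g : bool -> bool -> seq bool -> K) :=
  row x ys h1 s (fun h1 o => row y ys h2 o (g h1)).

Notation row2 := dw_row2.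

Lemma dw_row2_cons x y z ys h1 h2 v s g :
  row2 x y (z :: ys) h1 h2 (v :: s) g =
  vtx (x * z) v h1 (fun v h1 => vtx (y * z) v h2 (fun v h2 =>
    row2 x y ys h1 h2 s (fun h1 h2 o => g h1 h2 (v :: o)))).
Proof.
by apply: vertex_ext => l1 k1; rewrite vertex_dw_row; apply: dw_row_ext.
Qed.

Lemma ybe_dw_row2 x y ys h1 h2 s g : x != 0 -> y != 0 -> nz ys ->
  R x y h1 h2 (fun h1 h2 => row2 x y ys h1 h2 s g) =
  row2 y x ys h1 h2 s (fun h1 h2 o => R x y h1 h2 (fun h1 h2 => g h1 h2 o)).
Proof.
move=> x0 y0; elim: ys h1 h2 s g => [|z ys IH] h1 h2 [|v s] g //.
- by move=> _; rewrite /row2 /Rcross /cross /=; case: eqP; rewrite !mulr0 ?addr0.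
- by move=> _; rewrite /row2 /Rcross /cross /=; case: eqP; rewrite !mulr0 ?addr0.
case/andP=> z0 nys; rewrite dw_row2_cons.
under Rcross_ext do rewrite dw_row2_cons.
rewrite (ybe_row q0 _ _ _ (fun v h1 h2 => row2 x y ys h1 h2 s _)) //.
by apply: vertex_ext => l1 k1; apply: vertex_ext => l2 k2; rewrite IH.
Qed.

(** The crossing is a scalar at both ends of the two rows, where the sums are 0, 0 and 1, 1. *)
Lemma dw_state_swap_row x y xs ys s pre : x != 0 -> y != 0 -> nz ys ->
  sg (q ^+ 2 * x / y) * Zd (pre ++ [:: x, y & xs]) ys s =
  sg (q ^+ 2 * x / y) * Zd (pre ++ [:: y, x & xs]) ys s.
Proof.
move=> x0 y0 nys; elim: pre s => [|z pre IH] s /=; last first.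
  by rewrite -!dw_row_scale; apply: dw_row_ext => -[] o _; rewrite ?mulr0.
have E a b : row a ys false s (fun h o => if h then row b ys false o (fun h o => if h then Zd xs ys o else 0) else 0)
    = row2 a b ys false false s (fun h1 h2 o => if h1 && h2 then Zd xs ys o else 0).
  by apply: dw_row_ext => -[] o _ //=; rewrite dw_row_eq0.
rewrite !E; have := ybe_dw_row2 false false s (fun h1 h2 o => if h1 && h2 then Zd xs ys o else 0) x0 y0 nys.
rewrite {1}/Rcross /cross /= => ->; rewrite -!dw_row_scale.
apply: dw_row_ext => h1 o _; rewrite -dw_row_scale; apply: dw_row_ext => h2 o' _.
by rewrite /Rcross /cross; case: h1 h2 => [] [] /=; rewrite ?mulr0 ?addr0.
Qed.

Lemma Rcross_dw_row x y p ys h s v1 v2 g :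
  R x y v1 v2 (fun v1 v2 => row p ys h s (g v1 v2)) =
  row p ys h s (fun h o => R x y v1 v2 (fun v1 v2 => g v1 v2 h o)).
Proof.
rewrite /Rcross /cross; case: eqP => _; first by rewrite dw_row_scale.
by rewrite dw_row_lin.
Qed.

Lemma dw_row_swap p x y ys h v1 v2 s k pre P G12 G21 :
  p != 0 -> x != 0 -> y != 0 -> size P = size pre ->
  (forall h P v1 v2 o, size P = size pre ->
     R x y v1 v2 (fun v1 v2 => G12 h (P ++ [:: v1, v2 & o])) = k * G21 h (P ++ [:: v1, v2 & o])) ->
  R x y v1 v2 (fun v1 v2 => row p (pre ++ [:: x, y & ys]) h (P ++ [:: v1, v2 & s]) G12) =
  k * row p (pre ++ [:: y, x & ys]) h (P ++ [:: v1, v2 & s]) G21.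
Proof.
move=> p0 x0 y0; elim: pre P h G12 G21 => [|u pre IH] [|l P] h G12 G21 //=.
  move=> _ G; rewrite (ybe_col q0 _ _ _ (fun h v1 v2 => row p ys h s _)) //.
  rewrite [RHS]vertex_scalel; apply: vertex_ext => l1 h1; rewrite [RHS]vertex_scalel; apply: vertex_ext => l2 h2.
  rewrite -dw_row_scale Rcross_dw_row.
  by apply: dw_row_ext => h3 o _; exact: (G h3 [::]).
move=> [sP] G; rewrite Rcross_vertex [RHS]vertex_scalel; apply: vertex_ext => l' h1.
by apply: IH => // h2 P' l1' l2' o sP'; apply: (G h2 (l' :: P')); rewrite /= sP'.
Qed.

(** Below the last row all column sums are 1, so the crossing that has descended through all rows
    becomes a scalar. *)
Lemma dw_state_swap_col x y xs ys v1 v2 s pre P : x != 0 -> y != 0 -> nz xs -> size P = size pre ->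
  R x y v1 v2 (fun v1 v2 => Zd xs (pre ++ [:: x, y & ys]) (P ++ [:: v1, v2 & s])) =
  sg (q ^+ 2 * x / y) * Zd xs (pre ++ [:: y, x & ys]) (P ++ [:: v1, v2 & s]).
Proof.
move=> x0 y0; elim: xs P v1 v2 s => [|z xs IH] P v1 v2 s /=.
  rewrite /Rcross /cross !all_cat /=; case: v1 v2 => [] [] /= _ _; rewrite ?andbF ?mulr0 ?addr0 //.
case/andP=> z0 nxs sP; apply: dw_row_swap => // -[] P' v1' v2' o sP'; first exact: IH.
by rewrite /Rcross /cross; case: eqP; rewrite !mulr0 ?addr0.
Qed.

Lemma dw_fun_swap_row x y xs ys pre : x != 0 -> y != 0 -> nz ys ->
  D (pre ++ [:: x, y & xs]) ys = D (pre ++ [:: y, x & xs]) ys.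
Proof.
move=> x0 y0 nys; apply: (swap_cancel q0 (g := fun x y => D (pre ++ [:: x, y & xs]) ys)) => // a b a0 b0.
exact: dw_state_swap_row.
Qed.

Lemma dw_fun_swap_col x y xs ys pre : x != 0 -> y != 0 -> nz xs ->
  D xs (pre ++ [:: x, y & ys]) = D xs (pre ++ [:: y, x & ys]).
Proof.
move=> x0 y0 nxs; apply: (swap_cancel q0 (g := fun x y => D xs (pre ++ [:: x, y & ys]))) => // a b a0 b0.
have := @dw_state_swap_col a b xs ys false false (nseq (size ys) false) pre (nseq (size pre) false) a0 b0 nxs (size_nseq _ _).
by rewrite {1}/Rcross /cross /= /D !size_cat !nseqD.
Qed.
End DomainWall.

(** * Frozen lines *)

Section Freeze.
Variables (K : fieldType) (q w : K).
Hypotheses (q0 : q != 0) (q8 : q ^+ 8 != 1) (w0 : w != 0).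
Notation vtx := (vertex q).
Notation R := (Rcross q).
Notation wa := (weight_a q).
Notation wb := (weight_b q).
Notation wc := (weight_c q).
Notation row := (dw_row q).
Notation Zd := (dw_state q).
Notation D := (dw_fun q).
Notation rowS := (ast_row q w).
Notation Z := (ast_state q w).
Notation F := (ast_fun q w).
Notation cornerL := (corner_left q w).
Notation cornerR := (corner_right q w).
Notation nz us := (all (fun u : K => u != 0) us).
Notation zS k := (nseq k (false, false)).
Notation PA x us := (\prod_(u <- us) wa (x * u)).
Notation PB x us := (\prod_(u <- us) wb (x * u)).

(** Next to a row sum 1 and below a column sum 0, a 1 would overflow the row and a -1 would make the
    column sum negative: only zeros of weight a remain. *)
Lemma dw_row_true x ys f :
  row x ys true (nseq (size ys) false) f = PA x ys * f true (nseq (size ys) false).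
Proof.
elim: ys f => [|y ys IH] f /=; first by rewrite big_nil mul1r.
by rewrite big_cons /vertex /vert /= IH mulrA.
Qed.

Lemma dw_row_false x ys f : (forall o, f true o = 0) ->
  row x ys false (nseq (size ys) false) f = PB x ys * f false (nseq (size ys) false).
Proof.
elim: ys f => [|y ys IH] f f0 /=; first by rewrite big_nil mul1r.
by rewrite big_cons /vertex /vert /= IH // dw_row_true f0 !mulr0 addr0 mulrA.
Qed.

Lemma ast_row_true x us f :
  rowS x us true false (zS (size us)) f = PA x us ^+ 2 * wa (x * w) * f true false (zS (size us)).
Proof.
elim: us f => [|u us IH] f /=.
  by rewrite big_nil /vertex /vert /= expr1n mul1r.
by rewrite big_cons /vertex /vert /= IH /=; ring.
Qed.

Lemma ast_row_false x us f : (forall v o, f true v o = 0) ->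
  rowS x us false false (zS (size us)) f = PB x us ^+ 2 * wb (x * w) * f false false (zS (size us)).
Proof.
elim: us f => [|u us IH] f f0 /=.
  by rewrite big_nil /vertex /vert /= f0 expr1n; ring.
rewrite {1}/vertex /vert /= IH; last by move=> v o; rewrite /vertex /vert /= f0 mulr0.
by rewrite ast_row_true /vertex /vert /= !f0 big_cons; ring.
Qed.

Lemma dw_row_cat x ys1 ys2 h s1 s2 f : size s1 = size ys1 ->
  row x (ys1 ++ ys2) h (s1 ++ s2) f =
  row x ys1 h s1 (fun h o1 => row x ys2 h s2 (fun h o2 => f h (o1 ++ o2))).
Proof.
elim: ys1 h s1 f => [|y ys1 IH] h [|v s1] f //= [ss].
by apply: vertex_ext => v1 h1; rewrite IH.
Qed.

(** In the first column the row sum is 0; below a column sum 1 neither sign is possible. *)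
Lemma dw_state_first y xs ys s :
  Zd xs (y :: ys) (true :: s) = PA y xs * Zd xs ys s.
Proof.
elim: xs s => [|x xs IH] s /=; first by rewrite big_nil mul1r.
rewrite big_cons -mulrA -[X in _ = _ * X]dw_row_scale /vertex /vert /= [y * x]mulrC.
by congr (_ * _); apply: dw_row_ext => -[] o _; rewrite ?mulr0.
Qed.

(** A -1 in the last column would leave its row with sum 0, so every row arrives there with sum 1
    and finds a zero of weight b. *)
Lemma dw_state_last y xs ys s : size s = size ys ->
  Zd xs (ys ++ [:: y]) (s ++ [:: true]) = PB y xs * Zd xs ys s.
Proof.
elim: xs s => [|x xs IH] s ss /=; first by rewrite big_nil mul1r all_cat /= andbT.
rewrite dw_row_cat // big_cons -dw_row_scale; apply: dw_row_ext => -[] o so.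
  by rewrite /= /vertex /vert /= mulr0 addr0 IH // mulrA [y * x]mulrC.
by rewrite /= /vertex /vert /= !mulr0.
Qed.

(** Without weight b the top left cell is a 1, and this makes the rest of its row and column
    zero. *)
Lemma dw_fun_first x y xs ys : wb (x * y) = 0 ->
  D (x :: xs) (y :: ys) = wc * PA x ys * PA y xs * D xs ys.
Proof.
move=> b0; rewrite /dw_fun /= /vertex /vert /= b0 dw_row_true dw_state_first; ring.
Qed.

(** Without weight a the first row cannot reach its last cell with sum 1, so its 1 stands there. *)
Lemma dw_fun_last x y xs ys : wa (x * y) = 0 ->
  D (x :: xs) (ys ++ [:: y]) = wc * PB x ys * PB y xs * D xs ys.
Proof.
move=> a0; rewrite /dw_fun /= size_cat nseqD dw_row_cat ?size_nseq //=.
rewrite dw_row_false.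
  by rewrite /vertex /vert /= mulr0 add0r dw_state_last ?size_nseq //; ring.
by move=> o; rewrite /vertex /vert /= a0 mul0r.
Qed.

Lemma dw_fun_move_col x xs ys pre : x != 0 -> nz ys -> nz xs ->
  D xs (pre ++ x :: ys) = D xs (pre ++ ys ++ [:: x]).
Proof.
move=> x0; elim: ys pre => [|y ys IH] pre //= /andP[y0 nys] nxs.
by rewrite dw_fun_swap_col // -cat_rcons IH // cat_rcons.
Qed.

Definition dw_diag us := D us us.
Notation DD := dw_diag.

Lemma sg_eq0 (z : K) : z != 0 -> sg z = 0 -> z ^+ 2 = 1.
Proof. by move=> z0 /eqP; rewrite subr_eq0 => /eqP E; rewrite expr2 {1}E mulVf. Qed.

Lemma wa_eq0 p : p != 0 -> wa p = 0 -> exists2 e, p = e / q & e ^+ 2 = 1.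
Proof.
move=> p0 /sg_eq0 E; exists (q * p); first by field; rewrite ?q0.
by apply: E; rewrite mulf_neq0.
Qed.

Lemma wb_eq0 p : p != 0 -> wb p = 0 -> exists2 e, p = e * q & e ^+ 2 = 1.
Proof.
move=> p0 /sg_eq0 E; exists (p / q); first by field; rewrite ?q0.
have E2 : (q / p) ^+ 2 = 1 by apply: E; rewrite mulf_neq0 ?invr_eq0.
by rewrite -[p / q]invrK invf_div exprVn E2 invr1.
Qed.

(** * Reduction of both partition functions at the interpolation points *)

Section Red.
Variables (x y : K) (us : seq K).
Hypotheses (x0 : x != 0) (y0 : y != 0) (nus : nz us).

Let sgN e (z : K) : e ^+ 2 = 1 -> sg (e * z) = e * sg z.
Proof.
move=> e1; have entry0 : e != 0 by apply/eqP => E; move/eqP: e1; rewrite E expr0n eq_sym oner_eq0.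
rewrite /sg invfM mulrBr; congr (_ - _ * _).
by apply: (mulfI entry0); rewrite mulfV // -e1.
Qed.

(** The outer left corner has to raise the row sum to 1, where it stays. This matches a 1 in the top
    left cell of the matrix. *)
Lemma freeze_b_diag : wb (x ^+ 2) = 0 -> F us = DD (w :: us) -> F (x :: us) = DD (x :: w :: us).
Proof.
move=> b0 E; have xx := b0; rewrite expr2 in xx.
have -> : F (x :: us) = sg (q ^+ 2 * w / x) * wa (x ^+ 2) * PA x us ^+ 2 * wa (x * w) * F us.
  by rewrite /ast_fun /= /corner_left /= b0 mul0r add0r ast_row_true /=; ring.
rewrite /DD dw_fun_first // -/(DD _) -E !big_cons.
have [e xe e1] := wb_eq0 (mulf_neq0 x0 x0) xx.
have -> : sg (q ^+ 2 * w / x) = e * wa (x * w).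
  rewrite -sgN //; congr sg; apply: (mulIf x0); rewrite divfK //.
  have -> : e * (q * (x * w)) * x = e * q * w * (x * x) by ring.
  by rewrite xe -[LHS]mulr1 -e1; ring.
have -> : wa (x ^+ 2) = e * wc.
  by rewrite -sgN //; congr sg; rewrite expr2 xe; ring.
by rewrite -[RHS]mul1r -e1; ring.
Qed.

(** The outer right corner does not accept a row sum 1, so the row stays at 0 until then. The
    matching 1 of the matrix is in the top right cell, and the column of [x] is moved there by
    symmetry. *)
Lemma freeze_a_diag : wa (x ^+ 2) = 0 -> F us = DD (w :: us) -> F (x :: us) = DD (x :: w :: us).
Proof.
move=> a0 E; have xx := a0; rewrite expr2 in xx.
have -> : F (x :: us) = wb (x ^+ 2) * sg (q ^+ 2 * x / w) * PB x us ^+ 2 * wb (x * w) * F us.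
  rewrite /ast_fun /= /corner_left /= ast_row_true ast_row_false /= ?a0; last by move=> v o; rewrite mul0r.
  by ring.
rewrite /DD (dw_fun_move_col [::]) //=; last 2 first.
- by rewrite w0 nus.
- by rewrite x0 w0 nus.
rewrite -cat_cons dw_fun_last // -/(DD _) -E !big_cons.
have [e xe e1] := wa_eq0 (mulf_neq0 x0 x0) xx.
have entry0 : e != 0 by apply/eqP => E'; move/eqP: e1; rewrite E' expr0n eq_sym oner_eq0.
have -> : sg (q ^+ 2 * x / w) = e * wb (x * w).
  rewrite -sgN //; congr sg.
  have -> : e * (q / (x * w)) = e * q * x / w / (x * x) by field; rewrite x0 w0.
  by rewrite xe; field; rewrite w0 q0 entry0.
have -> : wb (x ^+ 2) = e * wc.
  rewrite -sgN //; congr sg; rewrite expr2 xe -[LHS]mulr1 -e1; field; rewrite entry0 q0 //.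
by rewrite -[RHS]mul1r -e1; ring.
Qed.

Let sg_inv (z : K) : sg z^-1 = - sg z.
Proof. by rewrite /sg invrK opprB. Qed.

(* The configurations in which the two outer left corners do not both have
   weight c cancel. *)
Lemma freeze_b_pair : wb (x * y) = 0 -> F us = DD (w :: us) -> F (x :: y :: us) = DD (x :: y :: w :: us).
Proof.
move=> b0 E; have [e xe e1] := wb_eq0 (mulf_neq0 x0 y0) b0.
have entry0 : e != 0 by apply/eqP => E'; move/eqP: e1; rewrite E' expr0n eq_sym oner_eq0.
have axy : wa (x * y) = e * wc by rewrite -sgN //; congr sg; rewrite xe; ring.
have cx : sg (q ^+ 2 * w / x) = e * wa (y * w).
  rewrite -sgN //; congr sg; apply: (mulIf x0); rewrite divfK //.
  have -> : e * (q * (y * w)) * x = e * q * w * (x * y) by ring.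
  by rewrite xe -[LHS]mulr1 -e1; ring.
have cy : sg (q ^+ 2 * w / y) = e * wa (x * w).
  rewrite -sgN //; congr sg; apply: (mulIf y0); rewrite divfK //.
  have -> : e * (q * (x * w)) * y = e * q * w * (x * y) by ring.
  by rewrite xe -[LHS]mulr1 -e1; ring.
have by2 : wb (y ^+ 2) = - wb (x ^+ 2).
  rewrite /weight_b -sg_inv invf_div; congr sg.
  have -> : y = e * q / x by rewrite -xe; field.
  by rewrite !exprMn e1; field; rewrite x0 q0.
have -> : F (x :: y :: us) = (e * wc) ^+ 2 * PA x us ^+ 2 * PA y us ^+ 2 * wa (x * w) * wa (y * w)
    * wa (x ^+ 2) * wa (y ^+ 2) * (e * wa (y * w)) * (e * wa (x * w)) * F us.
  rewrite /ast_fun /= /corner_left /= !{1}/vertex /vert /= b0 !mul0r !add0r !ast_row_true /=.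
  (* [T] is the second row started with sum 0. It is reached in two ways, whose weights are opposite
     by [by2]. *)
  rewrite axy cx cy by2; set T := rowS _ _ _ _ _ _.
  transitivity ((1 - e ^+ 2) * (e * wb (x ^+ 2) * wc ^+ 2 * PA x us ^+ 2 * wa (x * w) * wa (x ^+ 2)
    * wa (y * w) * T) + (e * wc) ^+ 2 * PA x us ^+ 2 * PA y us ^+ 2 * wa (x * w) * wa (y * w)
    * wa (x ^+ 2) * wa (y ^+ 2) * (e * wa (y * w)) * (e * wa (x * w)) * Z us false (zS (size us))).
    by ring.
  by rewrite e1 subrr mul0r add0r.
rewrite /DD (@dw_fun_swap_col _ _ q0 q8 _ _ _ _ [::]) //=; last by rewrite x0 y0 w0 nus.
rewrite dw_fun_first // dw_fun_first; last by rewrite mulrC.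
rewrite -/(DD _) -E !big_cons.
rewrite -!expr2.
transitivity (e ^+ 2 * e ^+ 2 * (wc ^+ 2 * PA x us ^+ 2 * PA y us ^+ 2 * wa (x * w) ^+ 2 * wa (y * w) ^+ 2
    * wa (x ^+ 2) * wa (y ^+ 2) * F us)); first by ring.
by rewrite e1; ring.
Qed.

(* The configurations in which the two outer right corners do not both have
   weight c cancel. *)
Lemma freeze_a_pair : wa (x * y) = 0 -> F us = DD (w :: us) -> F (x :: y :: us) = DD (x :: y :: w :: us).
Proof.
move=> a0 E; have [e xe e1] := wa_eq0 (mulf_neq0 x0 y0) a0.
have entry0 : e != 0 by apply/eqP => E'; move/eqP: e1; rewrite E' expr0n eq_sym oner_eq0.
have bxy : wb (x * y) = e * wc.
  by rewrite -sgN //; congr sg; rewrite xe -[LHS]mulr1 -e1; field; rewrite q0 entry0.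
have yE : y = e / q / x by rewrite -xe; field.
have cx : sg (q ^+ 2 * x / w) = e * wb (y * w).
  by rewrite -sgN //; congr sg; rewrite yE; field; rewrite w0 x0 q0 entry0.
have cy : sg (q ^+ 2 * y / w) = e * wb (x * w).
  rewrite -sgN //; congr sg; rewrite yE; field; by rewrite w0 x0 q0.
have ay2 : wa (y ^+ 2) = - wa (x ^+ 2).
  by rewrite /weight_a -sg_inv; congr sg; rewrite yE !exprMn e1; field; rewrite x0 q0.
have -> : F (x :: y :: us) = (e * wc) ^+ 2 * PB x us ^+ 2 * PB y us ^+ 2 * wb (x * w) * wb (y * w)
    * wb (x ^+ 2) * wb (y ^+ 2) * (e * wb (y * w)) * (e * wb (x * w)) * F us.
  rewrite /ast_fun /= /corner_left /= !{1}/vertex /vert /= a0.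
  rewrite !ast_row_true /= !(mul0r, mulr0, addr0) [rowS x us false _ _ _]ast_row_false /=; last by move=> v o; rewrite mul0r.
  rewrite !ast_row_true /= bxy cx ay2; set T1 := rowS _ _ _ _ _ _; set T2 := rowS _ _ _ _ _ _.
  (* [T1] and [T2] have right column sum 0 and 1 at the second right corner. In this combination the
     final row sum 1 gets weight 0, so the second row stays at 0. *)
  have L : e * wc * (e * wb (y * w)) * T1 + wc * wa (x ^+ 2) * T2 =
      PB y us ^+ 2 * wb (y * w) * (e * wc * (e * wb (y * w)) * (e * wb (x * w)) * Z us false (zS (size us))).
    rewrite -ast_row_lin ast_row_false /=; first by rewrite cy; ring.
    move=> v o; rewrite ay2.
    transitivity ((1 - e ^+ 2) * (wc * wb (y * w) * wa (x ^+ 2) * Z us v o)); first by ring.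
    by rewrite e1 subrr mul0r.
  pose X := wb (x ^+ 2) * (e * wc) * PB x us ^+ 2 * wb (x * w).
  (* The last summand, where the second row starts with sum 1, vanishes by the same cancellation. *)
  transitivity (X * wb (y ^+ 2) * (e * wc * (e * wb (y * w)) * T1 + wc * wa (x ^+ 2) * T2) +
   (1 - e ^+ 2) * (X * sg (q ^+ 2 * w / y) * wc * wa (x ^+ 2) * (PA y us ^+ 2 * wa (y * w)) * wb (y * w) *
     Z us false (zS (size us)))).
    by rewrite /X; ring.
  by rewrite L e1 subrr mul0r addr0 /X; ring.
have nys : nz [:: y, w & us] by rewrite /= y0 w0.
rewrite /DD (@dw_fun_move_col x _ [:: y, w & us] [::]) //= ?x0 //.
rewrite (@dw_fun_move_col y _ ([:: w & us] ++ [:: x]) [::]) //=; first last.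
- by rewrite x0 y0 w0.
- by rewrite all_cat /= x0 w0 nus.
rewrite -cat_cons dw_fun_last // -cat_cons dw_fun_last; last by rewrite mulrC.
rewrite -/(DD _) -E !big_cons big_cat big_seq1 /= -!expr2.
transitivity (e ^+ 2 * e ^+ 2 * (wc ^+ 2 * PB x us ^+ 2 * PB y us ^+ 2 * wb (x * w) ^+ 2 * wb (y * w) ^+ 2
    * wb (x ^+ 2) * wb (y ^+ 2) * F us)); first by ring.
by rewrite e1; ring.
Qed.
End Red.
End Freeze.

(** * Degrees of the partition functions *)

Section Laurent.
Variable K : fieldType.

(* [g] is, on nonzero arguments, a combination of x^-d, ..., x^d. *)
Definition laurent d (g : K -> K) :=
  exists2 P : {poly K}, (size P <= (2 * d).+1)%N & forall x, x != 0 -> x ^+ d * g x = P.[x].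

Lemma laurent_ext d f g : (forall x, x != 0 -> f x = g x) -> laurent d f -> laurent d g.
Proof. by move=> fg [P sP HP]; exists P => // x x0; rewrite -fg ?HP. Qed.

Lemma laurentD d f g : laurent d f -> laurent d g -> laurent d (fun x => f x + g x).
Proof.
move=> [P sP HP] [Q sQ HQ]; exists (P + Q).
  by rewrite (leq_trans (size_polyD _ _)) // geq_max sP.
by move=> x x0; rewrite mulrDr HP // HQ // hornerD.
Qed.

Lemma laurentM d e f g : laurent d f -> laurent e g -> laurent (d + e) (fun x => f x * g x).
Proof.
move=> [P sP HP] [Q sQ HQ]; exists (P * Q).
  by rewrite (leq_trans (size_polyMleq _ _)) //; lia.
by move=> x x0; rewrite hornerM -HP // -HQ // exprD; ring.
Qed.

Lemma laurentW d e f : (d <= e)%N -> laurent d f -> laurent e f.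
Proof.
move=> /subnK <- [P sP HP]; exists ('X^(e - d) * P).
  by rewrite (leq_trans (size_polyMleq _ _)) // size_polyXn; lia.
by move=> x x0; rewrite hornerM hornerXn -HP // exprD; ring.
Qed.

Lemma laurentC d k : laurent d (fun _ => k).
Proof.
apply: (@laurentW 0) => //; exists k%:P; first by rewrite size_polyC; case: eqP.
by move=> x _; rewrite hornerC mul1r.
Qed.

Lemma laurentZ d k f : laurent d f -> laurent d (fun x => k * f x).
Proof. by move=> H; rewrite -[d]add0n; apply: laurentM => //; exact: laurentC. Qed.

Lemma laurentX : laurent 1 id.
Proof.
by exists 'X^2 => [|x _]; rewrite ?size_polyXn // hornerXn expr1 expr2.
Qed.

Lemma laurentV : laurent 1 (fun x => x^-1).
Proof.
by exists 1 => [|x x0]; rewrite ?size_poly1 // hornerC expr1 divff.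
Qed.

Lemma laurent_sgX k : laurent 1 (fun x => sg (k * x)).
Proof.
apply: (laurent_ext (f := fun x => k * x + - k^-1 * x^-1)).
  by move=> x _; rewrite /sg invfM mulNr.
by apply: laurentD; apply: laurentZ; [exact: laurentX | exact: laurentV].
Qed.

Lemma laurent_sgV k : laurent 1 (fun x => sg (k / x)).
Proof.
apply: (laurent_ext (f := fun x => k * x^-1 + - k^-1 * x)).
  by move=> x _; rewrite /sg invfM invrK mulNr.
by apply: laurentD; apply: laurentZ; [exact: laurentV | exact: laurentX].
Qed.

Lemma laurent_sgV2 k : laurent 2 (fun x => sg (k / (x * x))).
Proof.
apply: (laurent_ext (f := fun x => k * (x^-1 * x^-1) + - k^-1 * (x * x))).
  by move=> x _; rewrite /sg !invfM !invrK mulNr.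
apply: laurentD; apply: laurentZ; apply: (@laurentM 1 1);
  [exact: laurentV | exact: laurentV | exact: laurentX | exact: laurentX].
Qed.

Variables q w : K.
Notation vtx := (vertex q).
Notation wa := (weight_a q).
Notation wb := (weight_b q).
Notation wc := (weight_c q).
Notation row := (dw_row q).
Notation Zd := (dw_state q).
Notation D := (dw_fun q).
Notation rowS := (ast_row q w).
Notation Z := (ast_state q w).
Notation F := (ast_fun q w).

Lemma laurent_wa k : laurent 1 (fun x => wa (k * x)).
Proof. by apply: laurent_ext (laurent_sgX (q * k)) => x _; rewrite /weight_a mulrA. Qed.

Lemma laurent_wb k : laurent 1 (fun x => wb (k * x)).
Proof. by apply: laurent_ext (laurent_sgV (q / k)) => x _; rewrite /weight_b invfM mulrA. Qed.

Lemma laurent_vtxC d p v h (f : K -> bool -> bool -> K) :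
  (forall v h, laurent d (fun x => f x v h)) -> laurent d (fun x => vtx p v h (f x)).
Proof.
move=> Hf; rewrite /vertex /vert; case: (v == h); last exact: laurentZ.
by apply: laurentD; apply: laurentZ.
Qed.

Lemma laurent_vtx d k v h (f : K -> bool -> bool -> K) :
  (forall v h, laurent d (fun x => f x v h)) -> laurent d.+1 (fun x => vtx (k * x) v h (f x)).
Proof.
move=> Hf; rewrite /vertex /vert; case: (v == h).
  apply: laurentD; last by apply: (laurentW (leqnSn d)); apply: laurentZ.
  by apply: (@laurentM 1 d) => //; exact: laurent_wb.
by apply: (@laurentM 1 d) => //; exact: laurent_wa.
Qed.

Lemma laurent_rowC d z ys h s (f : K -> bool -> seq bool -> K) :
  (forall h o, laurent d (fun x => f x h o)) -> laurent d (fun x => row z ys h s (f x)).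
Proof.
elim: ys h s f => [|y ys IH] h [|v s] f Hf //=; try exact: laurentC.
by apply: laurent_vtxC => v' h'; apply: IH => h2 o.
Qed.

Lemma laurent_Zd xs ys s : laurent (size xs) (fun x => Zd xs (x :: ys) s).
Proof.
elim: xs s => [|z xs IH] [|v s] /=; try exact: laurentC.
apply: laurent_vtx => v' h'; apply: laurent_rowC => -[] o; [exact: IH|exact: laurentC].
Qed.

(* A row whose horizontal edge changes value contains a vertex of constant weight. *)
Lemma laurent_row d ys (h : bool) s (f : K -> bool -> seq bool -> K) :
  (forall o, laurent d.+1 (fun x => f x true o)) -> (forall o, laurent d (fun x => f x false o)) ->
  laurent (size ys + d + h) (fun x => row x ys h s (f x)).
Proof.
elim: ys h s f => [|y ys IH] h [|v s] f Ht Hf /=; try exact: laurentC.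
  by case: h; rewrite ?addn1 ?addn0.
have Hwa : laurent 1 (fun x => wa (x * y)).
  by apply: laurent_ext (laurent_wa y) => x _; rewrite mulrC.
have Hwb : laurent 1 (fun x => wb (x * y)).
  by apply: laurent_ext (laurent_wb y) => x _; rewrite mulrC.
have IH' h' v' := IH h' s (fun x h o => f x h (v' :: o)) (fun o => Ht (v' :: o)) (fun o => Hf (v' :: o)).
rewrite /vertex /vert; case: v h => [] [] /=.
- apply: laurentD; first exact: (laurentM Hwb (IH' true true)).
  by apply: laurentZ; apply: laurentW (IH' false false); rewrite /= ?addn1 ?addn0; lia.
- exact: (laurentM Hwa (IH' false true)).
- exact: (laurentM Hwa (IH' true false)).
- apply: laurentD; first exact: (laurentM Hwb (IH' false false)).
  by apply: laurentZ; apply: laurentW (IH' true true); rewrite /= ?addn1 ?addn0; lia.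
Qed.

(** The corner cell is of degree 2 in [x], which suggests [2 * size ls + 2]. The 1 of the first row
    has constant weight: at the corner it saves two degrees, elsewhere one. *)
Lemma laurent_D ls : (0 < size ls)%N -> laurent (2 * size ls).+1 (fun x => D (x :: ls) (x :: ls)).
Proof.
move=> ls0; have [k sk] : {k | size ls = k.+1} by exists (size ls).-1; rewrite prednK.
have H (h : bool) v s : laurent (size ls + k + h) (fun x => row x ls h s (fun h o => if h then Zd ls (x :: ls) (v :: o) else 0)).
  by apply: laurent_row => o; [rewrite -sk; exact: laurent_Zd | exact: laurentC].
apply: (laurent_ext (f := fun x =>
    wb (x * x) * row x ls false (nseq (size ls) false) (fun h o => if h then Zd ls (x :: ls) (false :: o) else 0) +
    wc * row x ls true (nseq (size ls) false) (fun h o => if h then Zd ls (x :: ls) (true :: o) else 0))) => //.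
apply: laurentD; last first.
  by apply: laurentZ; apply: laurentW (H true true _); rewrite /= sk; lia.
apply: (@laurentW (2 + (size ls + k + false))); first by rewrite /= sk; lia.
exact: (laurentM (laurent_sgV2 q) (H false false _)).
Qed.

Lemma laurent_rowS d u us h vm s (f : K -> bool -> bool -> seq (bool * bool) -> K) :
  (forall h v o, laurent d (fun x => f x h v o)) ->
  laurent d.+2 (fun x => rowS u (us ++ [:: x]) h vm s (f x)).
Proof.
elim: us h vm s f => [|z us IH] h vm [|[l r] s] f Hf /=; try exact: laurentC.
  apply: laurent_vtx => v1 h1; case: s => [|? s]; last exact: laurentC.
  apply: laurent_vtxC => v2 h2; exact: laurent_vtx.
by apply: laurent_vtxC => v1 h1; apply: IH => h2 v2 o; apply: laurent_vtxC.
Qed.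

Hypotheses (q0 : q != 0) (w0 : w != 0).

Lemma laurent_Z1 vm l r : laurent 3 (fun x => Z [:: x] vm [:: (l, r)]).
Proof.
have HwaW : laurent 1 (fun x => wa (x * w)).
  by apply: laurent_ext (laurent_wa w) => x _; rewrite mulrC.
have HwbW : laurent 1 (fun x => wb (x * w)).
  by apply: laurent_ext (laurent_wb w) => x _; rewrite mulrC.
have HcL := laurent_sgV (q ^+ 2 * w).
have HcR : laurent 1 (fun x => sg (q ^+ 2 * x / w)).
  by apply: laurent_ext (laurent_sgX (q ^+ 2 / w)) => x _; rewrite mulrAC.
have HM3 f g h : laurent 1 f -> laurent 1 g -> laurent 1 h -> laurent 3 (fun x => f x * (g x * h x)).
  by move=> ? ? ?; apply: (@laurentM 1 2) => //; exact: (@laurentM 1 1).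
have H0 := laurentC 3 0; have Hc k := laurentC 1 k.
rewrite /= /corner_left /vertex /vert /=.
case: l vm r => [] [] [] /=; rewrite /vertex /vert /=.
- by apply: laurent_ext H0 => x _; ring.
- by apply: laurent_ext H0 => x _; ring.
- by apply: laurent_ext H0 => x _; ring.
- apply: (laurent_ext (f := fun x => wc * (wa (x * w) * (wb (x * w) * sg (q ^+ 2 * x / w))))).
    by move=> x _; ring.
  by apply: laurentZ; apply: HM3.
- by apply: laurent_ext H0 => x _; ring.
- apply: (laurent_ext (f := fun x => wc * (wc * (sg (q ^+ 2 * w / x) * sg (q ^+ 2 * x / w))))).
    by move=> x _; ring.
  by do 2!apply: laurentZ; apply: (@laurentW 2) => //; apply: (@laurentM 1 1).
- apply: (laurent_ext (f := fun x => wc * (sg (q ^+ 2 * w / x) * (wa (x * w) * wb (x * w))))).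
    by move=> x _; ring.
  by apply: laurentZ; apply: HM3.
(* The two terms of degree 4 cancel. *)
apply: (laurent_ext (f := fun x => wc ^+ 2 * (((q ^+ 2 + q ^- 2) * w ^+ 2 - w ^- 2) * (x * x) + - 2%:R +
   ((q ^+ 2 + q ^- 2) * w ^- 2 - w ^+ 2) * (x^-1 * x^-1)))).
  by move=> x x0; rewrite /weight_a /weight_b /weight_c /sg; field; rewrite x0 w0 q0.
apply: (@laurentW 2) => //; apply: laurentZ; apply: laurentD; last first.
  by apply: laurentZ; apply: (@laurentM 1 1); exact: laurentV.
apply: laurentD; last exact: laurentC.
by apply: laurentZ; apply: (@laurentM 1 1); exact: laurentX.
Qed.

(** With [x] innermost, each outer row meets the two columns of [x] and adds 2. The row of [x]
    itself consists of two corners and the central cell, so the delicate count is confined to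
    [laurent_Z1]. *)
Lemma laurent_Z us vm s : laurent (2 * size us).+3 (fun x => Z (us ++ [:: x]) vm s).
Proof.
elim: us vm s => [|u us IH] vm [|[l r] s] /=; try exact: laurentC.
  case: s => [|? ?]; first exact: laurent_Z1.
  apply: laurent_ext (laurentC 3 0) => x _.
  by rewrite /corner_left; case: l; rewrite !mulr0 ?addr0.
have H h : laurent (2 * size us).+3.+2 (fun x => rowS u (us ++ [:: x]) h vm s (fun h v o =>
     corner_right q w u r h * Z (us ++ [:: x]) v o)).
  by apply: laurent_rowS => h' v' o; apply: laurentZ.
have -> : (2 * (size us).+1).+3 = (2 * size us).+3.+2 by lia.
rewrite /corner_left; case: l; first exact: laurentZ.
by apply: laurentD; exact: laurentZ.
Qed.

Lemma laurent_F us : laurent (2 * size us).+3 (fun x => F (us ++ [:: x])).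
Proof.
apply: laurent_ext (laurent_Z us false (nseq (size us + 1) (false, false))) => x _.
by rewrite /ast_fun size_cat.
Qed.
End Laurent.

(** * The inhomogeneous identity *)

Lemma move_front (T : Type) (A : Type) (P : pred T) (f : seq T -> A) :
  (forall pre x y us, all P (pre ++ [:: x, y & us]) -> f (pre ++ [:: x, y & us]) = f (pre ++ [:: y, x & us])) ->
  forall x pre us1 us2, all P (pre ++ us1 ++ x :: us2) -> f (pre ++ us1 ++ x :: us2) = f (pre ++ x :: us1 ++ us2).
Proof.
move=> swp x pre us1; elim: us1 pre => [|u us1 IH] pre us2 //= H.
have [Hp Hu H1 Hx H2] : [/\ all P pre, P u, all P us1, P x & all P us2].
  by move: H; rewrite all_cat /= all_cat /= => /and5P[].
rewrite -cat_rcons IH; last by rewrite all_cat all_rcons /= all_cat /= Hp Hu H1 Hx.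
by rewrite cat_rcons swp // all_cat /= all_cat Hp Hu H1 Hx.
Qed.

Arguments move_front [T A P f] _ x pre us1 us2 _.

Section Main.
Variable K : numFieldType.
Variables q w r im : K.
Hypotheses (q0 : q != 0) (w0 : w != 0) (q8 : q ^+ 8 != 1) (rq : r ^+ 2 = q) (im2 : im ^+ 2 = -1).
Notation F := (ast_fun q w).
Notation DD := (dw_diag q).
Notation wa := (weight_a q).
Notation wb := (weight_b q).
Notation nz us := (all (fun u : K => u != 0) us).

Lemma dw_diag_swap pre x y us : nz (pre ++ [:: x, y & us]) ->
  DD (pre ++ [:: x, y & us]) = DD (pre ++ [:: y, x & us]).
Proof.
move=> H; have H' := H; rewrite all_cat /= in H'; case/and4P: H' => npre x0 y0 nus.
rewrite /dw_diag dw_fun_swap_row // dw_fun_swap_col //.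
by rewrite all_cat /= npre x0 y0.
Qed.

Lemma ast_fun_swap_nz pre x y us : nz (pre ++ [:: x, y & us]) ->
  F (pre ++ [:: x, y & us]) = F (pre ++ [:: y, x & us]).
Proof. by rewrite all_cat /= => /and4P[*]; apply: ast_fun_swap. Qed.

(* [r] and [im] serve to write down the solutions of x^4 = q^2 and x^4 = q^-2. *)
Definition node u : seq K := [:: q / u; - (q / u); (q * u)^-1; - (q * u)^-1].
Definition nodes0 : seq K := [:: r; - r; im * r; - (im * r); r^-1; - r^-1; im / r; - (im / r)].
Definition nodes us := flatten [seq node u | u <- us] ++ nodes0.
Definition generic us := uniq (nodes us).

Lemma r_neq0 : r != 0.
Proof. by apply/eqP => E; move: q0; rewrite -rq E expr0n eqxx. Qed.

Lemma im_neq0 : im != 0.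
Proof. by apply/eqP => /eqP E; move/eqP: im2; rewrite (eqP E) expr0n eq_sym oppr_eq0 oner_eq0. Qed.

Lemma nodesP us y : nz us -> y \in nodes us ->
  [/\ y != 0 & (exists2 u, u \in us & (wa (y * u) = 0) \/ (wb (y * u) = 0)) \/ wa (y ^+ 2) = 0 \/ wb (y ^+ 2) = 0].
Proof.
have s1 : sg (1 : K) = 0 by rewrite /sg invr1 subrr.
have sN1 : sg (-1 : K) = 0 by rewrite /sg invrN invr1 subrr.
have r0 := r_neq0; have im0 := im_neq0.
move=> nus; rewrite mem_cat => /orP[/flattenP[l /mapP[u uus ->]]|].
  have u0 : u != 0 by exact: (allP nus).
  rewrite !inE => H; split.
    by case/or4P: H => /eqP ->; rewrite ?oppr_eq0 ?invr_eq0 ?mulf_neq0 ?invr_eq0.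
  left; exists u => //; case/or4P: H => /eqP ->.
  - by right; rewrite /weight_b divfK // divff.
  - by right; rewrite /weight_b mulNr divfK // invrN mulrN divff.
  - by left; rewrite /weight_a mulrCA mulVf ?mulf_neq0.
  - by left; rewrite /weight_a mulNr mulrN mulrCA mulVf ?mulf_neq0.
have ri2 : r^-1 ^+ 2 = q^-1 by rewrite exprVn rq.
have imr2 : (im * r) ^+ 2 = - q by rewrite exprMn im2 rq mulN1r.
have imri2 : (im / r) ^+ 2 = - q^-1 by rewrite exprMn im2 ri2 mulN1r.
have A : all (fun y => (y != 0) && ((wa (y ^+ 2) == 0) || (wb (y ^+ 2) == 0))) nodes0.
  have wbq : wb q = 0 by rewrite /weight_b divff.
  have wbNq : wb (- q) = 0 by rewrite /weight_b invrN mulrN divff.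
  have waV : wa q^-1 = 0 by rewrite /weight_a divff.
  have waNV : wa (- q^-1) = 0 by rewrite /weight_a mulrN divff.
  rewrite /= !sqrrN rq ri2 imr2 imri2 wbq wbNq waV waNV eqxx !orbT !andbT.
  by rewrite !oppr_eq0 !mulf_eq0 !invr_eq0 (negPf r0) (negPf im0).
by move/(allP A) => /andP[y0 H]; split=> //; right; case/orP: H => /eqP; auto.
Qed.

Lemma size_nodes us : size (nodes us) = (4 * size us + 8)%N.
Proof. by rewrite size_cat; congr addn; elim: us => //= u us ->; lia. Qed.

Lemma nodes_subseq us vs : subseq us vs -> subseq (nodes us) (nodes vs).
Proof.
move=> sub; apply: cat_subseq => //; elim: vs us sub => [|v vs IH] [|u us] sub //.
rewrite [map _ (v :: _)]map_cons [flatten (_ :: _)]/flatten [foldr _ _ _]/= -/(flatten _).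
move: sub; rewrite [X in is_true X -> _]/=; case: eqP => [->|_] /IH H; first exact: (cat_subseq (subseq_refl (node _)) H).
exact: (subseq_trans H (suffix_subseq (node v) _)).
Qed.

(** With k = [size us], the polynomial has degree at most 4k + 6 and vanishes at the 4k + 8 nodes.
    The hypothesis on subsequences is used for [us] at [nodes0], and for [us] without [u] at the
    nodes of [u]. *)
Lemma ast_fun_dw_diag_step us x : nz (us ++ [:: x]) -> generic us ->
  (forall vs, subseq vs us -> F vs = DD (w :: vs)) -> F (us ++ [:: x]) = DD (x :: w :: us).
Proof.
rewrite all_cat /= andbT => /andP[nus x0] gus IH.
have : laurent (2 * size us).+3 (fun x => F (us ++ [:: x]) + - DD (x :: w :: us)).
  apply: laurentD; first exact: laurent_F.
  have -> : (2 * size us).+3 = (2 * (size (w :: us))).+1 by rewrite /=; lia.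
  have H := @laurent_D K q (w :: us) isT; have H2 := laurentZ (-1) H.
  by apply: laurent_ext H2 => y _; rewrite mulN1r.
case=> P sP HP; suff P0 : P = 0.
  move: (HP _ x0); rewrite P0 horner0 => /eqP; rewrite mulf_eq0 expf_eq0 (negPf x0) andbF /=.
  by rewrite subr_eq0 => /eqP.
apply/eqP; apply: contraTT sP => nP; rewrite -ltnNge.
apply: leq_trans (max_poly_roots nP _ gus); first by rewrite size_nodes; move: (size us) => k; lia.
apply/allP => y /(nodesP nus) [y0 H]; rewrite /root -HP // mulf_eq0; apply/orP; right.
rewrite subr_eq0; apply/eqP.
have -> : F (us ++ [:: y]) = F (y :: us).
  by rewrite (move_front ast_fun_swap_nz y [::] us [::]) ?cats0 // !all_cat /= nus y0.
case: H => [[u uus H]|].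
  case/splitPr: uus nus IH gus => us1 us2.
  rewrite all_cat /= => /and3P[n1 u0 n2] IH _.
  rewrite (move_front ast_fun_swap_nz u [:: y] us1 us2) /=; last by rewrite all_cat /= y0 u0 n1.
  rewrite (move_front dw_diag_swap u [:: y] (w :: us1) us2) /=; last by rewrite all_cat /= y0 u0 w0 n1.
  have E : F (us1 ++ us2) = DD (w :: us1 ++ us2).
    by apply: IH; apply: cat_subseq => //; exact: subseq_cons.
  have n12 : nz (us1 ++ us2) by rewrite all_cat n1.
  by case: H => H; [apply: freeze_a_pair | apply: freeze_b_pair].
by case=> H; [apply: freeze_a_diag | apply: freeze_b_diag] => //; exact: IH.
Qed.

Lemma ast_fun_dw_diag_generic us : nz us -> generic us -> F us = DD (w :: us).
Proof.
have [n] := ubnP (size us); elim: n us => // n IH us.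
elim/last_ind: us => [|us x _].
  by move=> _ _ _; rewrite /ast_fun /dw_diag /dw_fun /= /vertex /vert /= mulr0 mulr1 add0r.
rewrite size_rcons => sn nus gus.
have sub : subseq us (rcons us x) by exact: subseq_rcons.
rewrite -cats1 ast_fun_dw_diag_step ?cats1 //.
- apply/esym; rewrite -cats1; rewrite (move_front dw_diag_swap x [::] (w :: us) [::]) ?cats0 //.
  by rewrite /= w0 all_cat /= andbT; move: nus; rewrite all_rcons => /andP[-> ->].
- exact: subseq_uniq (nodes_subseq sub) gus.
move=> vs svs; apply: IH; first by rewrite (leq_ltn_trans (size_subseq svs)).
  by apply/allP => u /(mem_subseq svs) /(mem_subseq sub) /(allP nus).
exact: subseq_uniq (nodes_subseq (subseq_trans svs sub)) gus.
Qed.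
Lemma uniq_opp2 (s t : K) : s != 0 -> t != 0 -> s ^+ 2 != t ^+ 2 -> uniq [:: s; - s; t; - t].
Proof.
move=> s0 t0 st.
have NN (u : K) : u != 0 -> (u == - u) = false by move=> u0; rewrite -addr_eq0 -mulr2n mulrn_eq0 (negPf u0).
have H1 : (s == t) = false by apply: contraNF st => /eqP ->.
have H2 : (s == - t) = false by apply: contraNF st => /eqP ->; rewrite sqrrN.
by rewrite /= !inE !negb_or NN // H1 H2 eqr_opp H1 NN // eqr_oppLR H2.
Qed.

(** The fourth powers are q^2 for the first four points and q^-2 for the others, and q^4 <> 1. *)
Lemma generic0 : generic [::].
Proof.
have r0 := r_neq0; have im0 := im_neq0.
have q4 : q ^+ 4 != 1 by apply: contra_neq q8 => E; rewrite (exprM q 4 2) E expr1n.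
have i4 : im ^+ 4 = 1 by rewrite (exprM im 2 2) im2 sqrrN expr1n.
have r4 : r ^+ 4 = q ^+ 2 by rewrite (exprM r 2 2) rq.
have Nexp4 (x : K) : (- x) ^+ 4 = x ^+ 4 by rewrite exprNn -signr_odd mul1r.
rewrite -[generic _]/(uniq ([:: r; - r; im * r; - (im * r)] ++ [:: r^-1; - r^-1; im / r; - (im / r)])).
have NN (u : K) : u != 0 -> u != - u by move=> u0; rewrite -addr_eq0 -mulr2n mulrn_eq0 (negPf u0).
rewrite cat_uniq !uniq_opp2 ?mulf_neq0 ?invr_eq0 //=.
- rewrite andbT -[X in ~~ X]/(has (mem _) [:: _; _; _; _]); apply/hasPn => y yL.
  have {yL} y4 : y ^+ 4 = q ^- 2.
    by move: yL; rewrite !inE => /or4P[] /eqP ->; rewrite ?Nexp4 ?exprMn ?i4 exprVn r4 ?mul1r.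
  apply/negP => yL; have : y ^+ 4 = q ^+ 2.
    by move: yL; rewrite !inE => /or4P[] /eqP ->; rewrite ?Nexp4 ?exprMn ?i4 r4 ?mul1r.
  rewrite y4 => E; case/negP: q4; apply/eqP.
  by rewrite (exprD q 2 2) -{1}E mulVf // expf_neq0.
- by rewrite exprMn im2 mulN1r exprVn rq NN // invr_eq0.
- by rewrite exprMn im2 mulN1r rq NN.
Qed.

(** Being a node is symmetric: [e] belongs to [node x] exactly when [x] belongs to [node e]. The
    values of [x] to avoid therefore form a finite list that depends on [us] only. *)
Lemma generic_extend us x : x != 0 -> nz us -> generic us -> x \notin flatten [seq node e | e <- nodes us] ->
  generic (us ++ [:: x]).
Proof.
move=> x0 nus gus xE.
have q4 : q ^+ 4 != 1 by apply: contra_neq q8 => E; rewrite (exprM q 4 2) E expr1n.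
have -> : generic (us ++ [:: x]) = uniq (node x ++ nodes us).
  by rewrite /generic /nodes map_cat flatten_cat -catA; exact: uniq_catCA.
rewrite cat_uniq.
rewrite uniq_opp2 ?mulf_neq0 ?invr_eq0 ?mulf_neq0 //=; last first.
  apply: contra_neq q4 => E; have -> : q ^+ 4 = (q / x) ^+ 2 / ((q * x)^-1) ^+ 2 by field; rewrite x0 q0.
  by rewrite E divff // expf_neq0 // invr_eq0 mulf_neq0.
apply/andP; split=> //; apply/hasPn => e eus; have [entry0 _] := nodesP nus eus.
apply: contra xE => /= H; apply/flattenP; exists (node e); first exact: map_f.
move: H; rewrite !inE => /or4P[] /eqP H; apply/or4P.
- by apply: Or41; rewrite H; apply/eqP; field; rewrite x0 q0.
- by apply: Or42; rewrite H; apply/eqP; field; rewrite ?x0 ?q0 ?oppr_eq0 ?oner_eq0.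
- by apply: Or43; rewrite H; apply/eqP; field; rewrite x0 q0.
- by apply: Or44; rewrite H; apply/eqP; field; rewrite ?x0 ?q0 ?oppr_eq0 ?oner_eq0.
Qed.

(** Linear factors at the exceptional points turn [P] into a polynomial that vanishes everywhere, in
    particular at arbitrarily many natural numbers, which are distinct in [K]. *)
Lemma poly_cofinite_eq0 (P : {poly K}) (E : seq K) : (forall x, x \notin E -> P.[x] = 0) -> P = 0.
Proof.
move=> H; suff : P * \prod_(e <- E) ('X - e%:P) == 0.
  by rewrite mulf_eq0 (negPf (monic_neq0 (monic_prod_XsubC _ _ _))) orbF => /eqP.
set Q := _ * _; apply: contraT => Q0.
have := @max_poly_roots _ Q [seq i%:R | i <- iota 0 (size Q)] Q0.
rewrite size_map size_iota ltnn; apply.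
  apply/allP => x _; rewrite rootM; have [xE|xE] := boolP (x \in E); last by rewrite /root H // eqxx.
  by rewrite root_prod_XsubC xE orbT.
by rewrite map_inj_uniq ?iota_uniq // => i j /eqP; rewrite eqr_nat => /eqP.
Qed.

(* Generic parameters are replaced one at a time by arbitrary ones, a Laurent
   polynomial being determined by its values outside a finite set. *)
Lemma ast_fun_dw_diag us : nz us -> F us = DD (w :: us).
Proof.
suff H vs us0 : nz us0 -> generic us0 -> nz vs -> F (us0 ++ vs) = DD (w :: us0 ++ vs).
  by move=> nus; apply: (H us [::]) => //; exact: generic0.
elim: vs us0 => [|v vs IH] us0 n0 g0 /=; first by rewrite cats0 => _; apply: ast_fun_dw_diag_generic.
case/andP => v0 nvs; set us1 := us0 ++ vs.
have n1 : nz us1 by rewrite all_cat n0.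
have mvF x : x != 0 -> F (us0 ++ x :: vs) = F (us1 ++ [:: x]).
  move=> x0; rewrite /us1 -catA (move_front ast_fun_swap_nz x us0 vs [::]) ?cats0 //.
  by rewrite !all_cat /= x0 n0 nvs.
have mvD x : x != 0 -> DD (w :: us0 ++ x :: vs) = DD (x :: w :: us1).
  move=> x0; rewrite (move_front dw_diag_swap x [::] (w :: us0) vs) //=.
  by rewrite w0 all_cat /= x0 n0 nvs.
have : laurent (2 * size us1).+3 (fun x => F (us1 ++ [:: x]) + - DD (x :: w :: us1)).
  apply: laurentD; first exact: laurent_F.
  have -> : (2 * size us1).+3 = (2 * (size (w :: us1))).+1 by rewrite /=; lia.
  have H := @laurent_D K q (w :: us1) isT; have H2 := laurentZ (-1) H.
  by apply: laurent_ext H2 => y _; rewrite mulN1r.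
case=> P _ HP; suff P0 : P = 0.
  move: (HP _ v0); rewrite P0 horner0 => /eqP; rewrite mulf_eq0 expf_eq0 (negPf v0) andbF /=.
  by rewrite subr_eq0 mvF // mvD // => /eqP.
(* The value 0 is excluded because [laurent] says nothing there, the other values in order that [us0
   ++ [:: x]] stay generic. *)
apply: (@poly_cofinite_eq0 P (0 :: flatten [seq node e | e <- nodes us0])) => x.
rewrite inE negb_or => /andP[x0 xE]; rewrite -HP // -mvF // -mvD //.
have := IH (us0 ++ [:: x]); rewrite -catA /= => -> //; first by rewrite subrr mulr0.
  by rewrite all_cat n0 /= x0.
exact: generic_extend.
Qed.
End Main.

(** * Equal parameters *)

Section Homogeneous.
Variables (K : fieldType) (a b c : K).

Fixpoint hom_row h s (f : bool -> seq bool -> K) : K :=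
  if s is v :: s then vert a b c v h (fun v h => hom_row h s (fun h o => f h (v :: o)))
  else f h [::].

Definition trim (T : Type) (s : seq T) := behead (take (size s).-1 s).

Fixpoint hom_dw n s : K :=
  if n is n.+1 then hom_row false s (fun h o => if h then hom_dw n o else 0)
  else if all id s then 1 else 0.

(** [trim] removes the two columns that end with the row just read. Their sums are left free, as in
    a triangle. *)
Fixpoint hom_ast n s : K :=
  if n is n.+1 then hom_row false s (fun h o => if h then hom_ast n (trim o) else 0)
  else 1.

Lemma hom_row_ext h s f g :
  (forall h o, size o = size s -> f h o = g h o) -> hom_row h s f = hom_row h s g.
Proof.
elim: s h f g => [|v s IH] h f g fg /=; first exact: fg.
by apply: vert_ext => v1 h1; apply: IH => h2 o so; apply: fg; rewrite /= so.
Qed.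

Lemma hom_row_cat h s1 s2 f :
  hom_row h (s1 ++ s2) f = hom_row h s1 (fun h o1 => hom_row h s2 (fun h o2 => f h (o1 ++ o2))).
Proof. by elim: s1 h f => [|v s1 IH] h f //=; apply: vert_ext => v1 h1; rewrite IH. Qed.

Lemma hom_row_scale h s k f : hom_row h s (fun h o => k * f h o) = k * hom_row h s f.
Proof.
elim: s h f => [|v s IH] h f //=; rewrite mulrC vert_scale.
by apply: vert_ext => v1 h1; rewrite mulrC -IH.
Qed.

Lemma trimE (T : Type) (x y : T) s : trim (x :: s ++ [:: y]) = s.
Proof. by rewrite /trim /= size_cat addn1 /= take_size_cat. Qed.
End Homogeneous.

Lemma hom_row_norm (K : fieldType) (a b c : K) h s f : a != 0 ->
  hom_row a b c h s f = a ^+ size s * hom_row 1 (b / a) (c / a) h s f.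
Proof.
move=> a0; elim: s h f => [|v s IH] h f /=; first by rewrite mul1r.
rewrite /vert; case: eqP => _; rewrite !IH exprS; first by field.
by ring.
Qed.

Lemma hom_dw_norm (K : fieldType) (a b c : K) n s : a != 0 ->
  hom_dw a b c n s = a ^+ (n * size s) * hom_dw 1 (b / a) (c / a) n s.
Proof.
move=> a0; elim: n s => [|n IH] s /=; first by rewrite mul0n mul1r.
rewrite hom_row_norm // mulSn exprD -mulrA; congr (_ * _); rewrite -hom_row_scale.
by apply: hom_row_ext => -[] o so; rewrite ?mulr0 // IH so.
Qed.

(** The triangle has 1 + 3 + ... + (2n - 1) = n^2 cells, as many as the square, so the same power of
    [a] drops out on both sides. *)
Lemma hom_ast_norm (K : fieldType) (a b c : K) n s : a != 0 -> size s = n.*2.-1 ->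
  hom_ast a b c n s = a ^+ (n * n) * hom_ast 1 (b / a) (c / a) n s.
Proof.
move=> a0; elim: n s => [|n IH] s ss /=; first by rewrite mul1r.
rewrite hom_row_norm //; have -> : (n.+1 * n.+1 = size s + n * n)%N by rewrite ss; lia.
rewrite exprD -mulrA; congr (_ * _); rewrite -hom_row_scale.
apply: hom_row_ext => -[] o so; rewrite ?mulr0 // IH //.
by rewrite /trim size_behead size_takel ?leq_pred // so ss; lia.
Qed.

Section Specialise.
Variables (K : fieldType) (q u : K).
Hypothesis u0 : u != 0.
Notation a := (weight_a q (u * u)).
Notation b := (weight_b q (u * u)).
Notation c := (weight_c q).

Lemma dw_row_hom k h s f : size s = k -> dw_row q u (nseq k u) h s f = hom_row a b c h s f.
Proof. by elim: s k h f => [|v s IH] [|k] h f //= [sk]; apply: vert_ext => v1 h1; exact: IH. Qed.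

Lemma dw_state_hom n k s : size s = k -> dw_state q (nseq n u) (nseq k u) s = hom_dw a b c n s.
Proof.
elim: n s => [|n IH] s sk //=; rewrite dw_row_hom //.
by apply: hom_row_ext => -[] o so //; rewrite IH // so.
Qed.

Lemma dw_diag_hom n : dw_diag q (nseq n u) = hom_dw a b c n (nseq n false).
Proof. by rewrite /dw_diag /dw_fun dw_state_hom ?size_nseq. Qed.

Definition flat (vm : bool) (s : seq (bool * bool)) := unzip1 s ++ vm :: rev (unzip2 s).

Lemma flat_cons vm l r s : flat vm ((l, r) :: s) = l :: flat vm s ++ [:: r].
Proof. by rewrite /flat /= rev_cons -cats1 -catA. Qed.

Lemma ast_row_hom k h vm s g : size s = k ->
  ast_row q u u (nseq k u) h vm s (fun h v o => g h (flat v o)) = hom_row a b c h (flat vm s) g.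
Proof.
elim: k h vm s g => [|k IH] h vm [|[l r] s] g // [sk].
rewrite flat_cons /=; apply: vert_ext => v1 h1; rewrite hom_row_cat -IH //.
apply: ast_row_ext => h2 v2 o _; apply: vert_ext => v3 h3.
by rewrite flat_cons.
Qed.

Lemma ast_state_hom k vm s : size s = k -> ast_state q u (nseq k u) vm s = hom_ast a b c k.+1 (flat vm s).
Proof.
elim: k vm s => [|k IH] vm [|[l r] s] //.
  by case: vm => _ /=; rewrite /vert /= ?mulr0 ?mulr1 ?add0r.
move=> [sk]; rewrite [LHS]/= flat_cons [hom_ast]lock /= -lock [RHS]/=.
(* At equal parameters a left corner is an ordinary cell that starts its row; its column sum is not
   passed on because the column ends there. *)
have -> f : corner_left q u u l f = vert a b c l false (fun _ h => f h).
  by rewrite /corner_left /vert /weight_c expr2 mulfK //; case: l.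
apply: vert_ext => v1 h1; rewrite hom_row_cat -(@ast_row_hom k) //.
apply: ast_row_ext => h2 v2 o; rewrite size_nseq => so.
have -> : corner_right q u u r h2 = vert a b c r h2 (fun _ h => if h then 1 else 0).
  by rewrite /corner_right /vert /weight_c expr2 mulfK //; case: r h2 => [] [] /=; rewrite ?mulr0 ?mulr1 ?add0r ?addr0.
rewrite vert_scale; apply: vert_ext => v3 h3 /=; case: h3; rewrite ?mul0r // mul1r IH //.
by rewrite -[_ :: _ ++ _]/(v1 :: flat v2 o ++ [:: v3]) trimE.
Qed.

Lemma ast_fun_hom k : ast_fun q u (nseq k u) = hom_ast a b c k.+1 (nseq k.*2.+1 false).
Proof.
rewrite /ast_fun size_nseq ast_state_hom ?size_nseq //; congr hom_ast; rewrite /flat.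
have -> : unzip1 (nseq k (false, false)) = nseq k false by rewrite /unzip1 map_nseq.
have -> : unzip2 (nseq k (false, false)) = nseq k false by rewrite /unzip2 map_nseq.
have -> : rev (nseq k false) = nseq k false.
  by elim: k => //= k IH; rewrite rev_cons IH -cats1 -(nseqD k 1) addn1.
by rewrite -[false :: _]/(nseq k.+1 false) -nseqD; congr nseq; lia.
Qed.
End Specialise.

(** * Sums over arrays of entries *)

Lemma sum_entry (V : nmodType) (f : int -> V) :
  \sum_(t : entry) f (t : int) = f 0 + f 1 + f (-1).
Proof.
have -> : \sum_(t : entry) f (t : int) = \sum_(x <- [:: 0; 1; -1 : int]) f x.
  rewrite -(big_map entry_val predT f); apply: perm_big.
  apply: uniq_perm => // [|x].
    by rewrite map_inj_uniq ?index_enum_uniq // => x y; exact: val_inj.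
  apply/mapP/idP => [[y _ ->]|xs]; first exact: ssvalP.
  by exists (SeqSub xs) => //; rewrite mem_index_enum.
by rewrite !big_cons big_nil addr0 addrA.
Qed.

Definition bit (v : int) := (v == 0) || (v == 1).

Section Cells.
Variables (K : fieldType) (b c : K).

(** Integer sums allow a summation over all arrays of entries; those with a partial sum outside {0,
    1} get weight 0. *)
Definition cell_wt (v h t : int) : K :=
  if [&& bit v, bit (v + t), bit h & bit (h + t)]
  then (if t == 0 then (if v == h then b else 1) else c) else 0.

Lemma vert_cell_wt (v h : bool) (f : bool -> bool -> K) (g : int -> K) :
  (forall (v' h' : bool) t, (v%:Z + t = v'%:Z) -> (h%:Z + t = h'%:Z) -> g t = f v' h') ->
  \sum_(t : entry) cell_wt v h t * g t = vert 1 b c v h f.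
Proof.
move=> H; rewrite (sum_entry (fun t => cell_wt v h t * g t)) /vert /cell_wt.
case: v h H => [] [] H /=.
- by rewrite (H true true 0) // (H false false (-1)) //; ring.
- by rewrite (H true false 0) //; ring.
- by rewrite (H false true 0) //; ring.
- by rewrite (H false false 0) // (H true true 1) //; ring.
Qed.

Definition upd (V : nat -> int) j x := fun j' => if j' == j then x else V j'.

Fixpoint updl (V : nat -> int) js (o : seq bool) :=
  match js, o with
  | j :: js, v :: o => updl (upd V j v%:Z) js o
  | _, _ => V
  end.

Variables (P : finType) (row col : P -> nat).
Variable final : (nat -> int) -> (nat -> int) -> K.
Hypothesis final_ext : forall V V' H H', V =1 V' -> H =1 H' -> final V H = final V' H'.

(* [V] and [H] are the column and row sums of the cells treated so far, and
   [final] scores the sums of the whole array. *)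
Fixpoint cell_sum ps V H : K :=
  if ps is p :: ps then
    \sum_(t : entry) cell_wt (V (col p)) (H (row p)) t *
      cell_sum ps (upd V (col p) (V (col p) + t)) (upd H (row p) (H (row p) + t))
  else final V H.

Fixpoint cell_prod ps V H (T : {ffun P -> entry}) : K :=
  if ps is p :: ps then
    cell_wt (V (col p)) (H (row p)) (T p) *
      cell_prod ps (upd V (col p) (V (col p) + T p)) (upd H (row p) (H (row p) + T p)) T
  else final V H.

Lemma upd_ext V V' j x : V =1 V' -> upd V j x =1 upd V' j x.
Proof. by move=> VV j'; rewrite /upd VV. Qed.

Lemma cell_sum_ext ps V V' H H' : V =1 V' -> H =1 H' -> cell_sum ps V H = cell_sum ps V' H'.
Proof.
elim: ps V V' H H' => [|p ps IH] V V' H H' VV HH /=; first exact: final_ext.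
by apply: eq_bigr => t _; rewrite VV HH; congr (_ * _); apply: IH; exact: upd_ext.
Qed.

(** The passage to the transfer recursion: between sums in {0, 1}, the sum over the possible entries
    of a cell is [vert]. *)
Lemma cell_sum_row i rc rest V H (h : bool) s :
  all (fun p => row p == i) rc -> uniq (map col rc) -> [seq V (col p) | p <- rc] = [seq (v : bool)%:Z | v <- s] ->
  H i = h%:Z ->
  cell_sum (rc ++ rest) V H =
  hom_row 1 b c h s (fun h o => cell_sum rest (updl V (map col rc) o) (upd H i h%:Z)).
Proof.
elim: rc V H h s => [|p rc IH] V H h [|v s] //=.
  by move=> _ _ _ Hi; apply: cell_sum_ext => // j; rewrite /upd; case: eqP => // ->.
case/andP => /eqP rp arc /andP[prc urc] [Vp Vrc] Hi.
rewrite Vp rp Hi; apply: (vert_cell_wt (g := fun t => cell_sum (rc ++ rest) (upd V (col p) (v%:Z + t)) (upd H i (h%:Z + t)))) => v' h' t E1 E2.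
rewrite (IH _ _ h' s) //.
- apply: hom_row_ext => h2 o _; rewrite E1; apply: cell_sum_ext => // j.
  by rewrite /upd; case: eqP.
- rewrite -Vrc; apply/eq_in_map => p' p'rc; rewrite /upd ifN //.
  by apply: contraNneq prc => <-; exact: map_f.
- by rewrite /upd eqxx E2.
Qed.

Lemma updl_notin V js o j : j \notin js -> updl V js o j = V j.
Proof.
elim: js o V => [|j' js IH] [|v o] V //=; rewrite inE negb_or => /andP[jj' jjs].
by rewrite IH // /upd (negPf jj').
Qed.

Lemma map_updl V js o : uniq js -> size o = size js -> map (updl V js o) js = [seq v%:Z | v : bool <- o].
Proof.
elim: js o V => [|j js IH] [|v o] V //= /andP[jjs ujs] [so].
by rewrite updl_notin // /upd eqxx -(IH _ (upd V j v%:Z)).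
Qed.

Lemma cell_sum_eq0 ps V H i : (forall V H, H i != 1 -> final V H = 0) ->
  all (fun p => row p != i) ps -> H i != 1 -> cell_sum ps V H = 0.
Proof.
move=> f0; elim: ps V H => [|p ps IH] V H /=; first by move=> _; exact: f0.
case/andP=> pi aps Hi; rewrite big1 // => t _; rewrite IH ?mulr0 // /upd [i == _]eq_sym (negPf pi) //.
Qed.

Definition entry0 : entry := SeqSub (mem_head (0 : int) [:: 1; -1]).

(** An array on the cells [ps] is encoded as an array on all of [P] that is zero elsewhere, so the
    index type is constant in inductions on [ps]. *)
Definition supported (ps : seq P) (T : {ffun P -> entry}) := [forall p, (p \in ps) || (T p == entry0)].

Definition set_at p (t : entry) (T : {ffun P -> entry}) : {ffun P -> entry} :=
  [ffun p' => if p' == p then t else T p'].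

Lemma cell_prod_set_at ps V H T p t : p \notin ps -> cell_prod ps V H (set_at p t T) = cell_prod ps V H T.
Proof.
elim: ps V H => [|p' ps IH] V H //=; rewrite inE negb_or => /andP[pp' pps].
by rewrite !ffunE eq_sym (negPf pp') IH.
Qed.

Lemma cell_sum_ffun ps V H : uniq ps -> cell_sum ps V H = \sum_(T | supported ps T) cell_prod ps V H T.
Proof.
elim: ps V H => [|p ps IH] V H /=.
  move=> _; rewrite (big_pred1 [ffun _ => entry0]) // => T; apply/forallP/eqP => [H0|-> p].
    by apply/ffunP => p; rewrite ffunE; move: (H0 p) => /= /eqP.
  by rewrite ffunE eqxx orbT.
case/andP => pps ups; rewrite (partition_big (fun T : {ffun P -> entry} => T p) predT) //=.
apply: eq_bigr => t _; rewrite IH // big_distrr /=.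
(* Putting [t] at [p] is a bijection from the arrays that vanish at [p] to those with entry [t]
   there; resetting [p] to zero is its inverse. *)
rewrite [RHS](reindex_onto (set_at p t) (set_at p entry0)); last first.
  move=> T /andP[_ /eqP Tp]; apply/ffunP => p'; rewrite !ffunE.
  by case: eqP => // ->; rewrite Tp.
apply: eq_big => [T|T _].
  rewrite [set_at p t T p]ffunE eqxx eqxx andbT; apply/forallP/andP => [sT|[/forallP sT /eqP ET] p'].
    split; first apply/forallP => p'.
      rewrite inE ffunE; case: eqP => //= _; exact: sT.
    apply/eqP/ffunP => p'; rewrite !ffunE; case: eqP => // ->.
    by move: (sT p); rewrite (negPf pps) => /eqP.
  move: (sT p'); rewrite inE ffunE; case: eqP => //= -> _.
  by rewrite -ET !ffunE eqxx orbT.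
by rewrite [set_at p t T p]ffunE eqxx cell_prod_set_at.
Qed.

(** * Reading order of the cells *)

Definition lex p' p := (row p' < row p)%N || (row p' == row p) && (col p' < col p)%N.

Lemma lex_irr : irreflexive lex.
Proof. by move=> p; rewrite /lex !ltnn andbF. Qed.

Lemma lex_asym p p' : lex p p' -> lex p' p = false.
Proof. by rewrite /lex; lia. Qed.

(** Within a column, earlier in reading order means above, and within a row to the left. The running
    sums are thereby the partial sums of the array. *)
Lemma cell_prodE ps V H T : pairwise lex ps ->
  cell_prod ps V H T =
  \prod_(p <- ps) cell_wt (V (col p) + \sum_(p' <- ps | lex p' p && (col p' == col p)) (T p' : int))
                     (H (row p) + \sum_(p' <- ps | lex p' p && (row p' == row p)) (T p' : int)) (T p) *
  final (fun j => V j + \sum_(p <- ps | col p == j) (T p : int))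
      (fun i => H i + \sum_(p <- ps | row p == i) (T p : int)).
Proof.
elim: ps V H => [|p ps IH] V H /=.
  by move=> _; rewrite big_nil mul1r; apply: final_ext => j; rewrite big_nil addr0.
case/andP=> /allP pps wps; rewrite IH // big_cons -mulrA; congr (_ * _); [|congr (_ * _)].
- rewrite !big1_seq ?addr0 // => p' /andP[/andP[lp _]]; rewrite inE => /orP[/eqP E|/pps /lex_asym].
  + by rewrite E lex_irr in lp.
  + by rewrite lp.
  + by rewrite E lex_irr in lp.
  + by rewrite lp.
- apply: eq_big_seq => p' /pps lp; congr cell_wt; rewrite big_cons lp /= /upd eq_sym.
    by case: eqP => [->|_]; rewrite ?addrA.
  by case: eqP => [->|_]; rewrite ?addrA.
- by apply: final_ext => j; rewrite big_cons /upd eq_sym; case: eqP => [->|_]; rewrite ?addrA.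
Qed.

Variable n : nat.
Hypothesis row_lt : forall p, (row p < n)%N.
Hypothesis row_col_inj : forall p p', row p = row p' -> col p = col p' -> p = p'.

Definition cells i := sort (fun p p' => col p <= col p')%N [seq p <- enum P | row p == i].

Lemma mem_cells i p : (p \in cells i) = (row p == i).
Proof. by rewrite mem_sort mem_filter mem_enum andbT. Qed.

Lemma cells_uniq i : uniq (map col (cells i)).
Proof.
rewrite map_inj_in_uniq; first by rewrite sort_uniq filter_uniq ?enum_uniq.
by move=> p p'; rewrite !mem_cells => /eqP E /eqP E'; apply: row_col_inj; rewrite E E'.
Qed.

Lemma cells_sorted i : sorted ltn (map col (cells i)).
Proof.
rewrite ltn_sorted_uniq_leq cells_uniq sorted_map.
by apply: sort_sorted => p p'; exact: leq_total.
Qed.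

Lemma map_col_cells i x k : (forall j, reflect (exists2 p, row p = i & col p = j) (j \in iota x k)) ->
  map col (cells i) = iota x k.
Proof.
move=> H; apply: (irr_sorted_eq ltn_trans ltnn) => //; [exact: cells_sorted | exact: iota_ltn_sorted | move=> j].
apply/mapP/H => [[p pc ->]|[p rp cp]]; exists p => //; first by apply/eqP; rewrite -mem_cells.
by rewrite mem_cells rp.
Qed.

Definition all_cells := flatten [seq cells i | i <- iota 0 n].

Lemma pairwise_cells : pairwise lex all_cells.
Proof.
rewrite /all_cells; elim: n 0%N => [|k IH] i //=.
rewrite pairwise_cat IH andbT; apply/andP; split.
  apply/allrelP => p p' /=; rewrite mem_cells => /eqP <- /flattenP[l /mapP[i' ii' ->]].
  by rewrite mem_cells => /eqP E; rewrite /lex; move: ii'; rewrite mem_iota; lia.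
have := cells_sorted i; rewrite (sorted_pairwise ltn_trans) pairwise_map.
apply: sub_in_pairwise (allss _) => p p'; rewrite !mem_cells => /eqP E /eqP E' /=.
by rewrite /lex E E' eqxx => ->; rewrite orbT.
Qed.

Lemma mem_all_cells p : p \in all_cells.
Proof.
apply/flattenP; exists (cells (row p)); last by rewrite mem_cells.
by apply: map_f; rewrite mem_iota /=.
Qed.

Lemma all_cells_uniq : uniq all_cells.
Proof. exact: pairwise_uniq lex_irr pairwise_cells. Qed.

Lemma cell_sum_all_cells :
  cell_sum all_cells (fun _ => 0) (fun _ => 0) =
  \sum_(T : {ffun P -> entry})
    \prod_p cell_wt (\sum_(p' | (row p' < row p)%N && (col p' == col p)) (T p' : int))
               (\sum_(p' | (row p' == row p) && (col p' < col p)%N) (T p' : int)) (T p) *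
    final (fun j => \sum_(p | col p == j) (T p : int)) (fun i => \sum_(p | row p == i) (T p : int)).
Proof.
rewrite cell_sum_ffun ?all_cells_uniq //; apply: eq_big => [T|T _].
  by apply/forallP => p; rewrite mem_all_cells.
have bigE (R : Type) (idx : R) (op : Monoid.com_law idx) (Q : pred P) (f : P -> R) :
    \big[op/idx]_(p <- all_cells | Q p) f p = \big[op/idx]_(p | Q p) f p.
  apply: perm_big; apply: uniq_perm; rewrite ?all_cells_uniq ?index_enum_uniq // => p.
  by rewrite mem_all_cells mem_index_enum.
rewrite cell_prodE ?pairwise_cells // bigE; congr (_ * _).
  apply: eq_bigr => p _; rewrite !add0r !bigE; congr cell_wt; apply: eq_bigl => p'; rewrite /lex.
    by lia.
  by lia.
by apply: final_ext => j; rewrite add0r bigE.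
Qed.
End Cells.

(** * Alternating sequences *)

Fixpoint bit_sums (h : int) (s : seq int) : bool :=
  if s is t :: s then [&& bit h, bit (h + t) & bit_sums (h + t) s] else true.

Definition entries (s : seq int) := all (fun x => x \in [:: 0; 1; -1]) s.

(* A partial sum in {0, 1} acts as a last nonzero entry: 1 after 1, 0 after -1 or
   at the beginning. *)
Lemma path_bit_sums (h : bool) s : entries s ->
  path (fun x y => x * y < 0) (if h then 1 else -1) (nonzeros s) = bit_sums h%:Z s.
Proof.
elim: s h => [|t s IH] h //= /andP[]; rewrite !inE => /or3P[] /eqP -> ss.
- by rewrite eqxx /= addr0 -(IH h) //; case: h.
- by case: h => //=; rewrite -(IH true).
- by case: h => //=; rewrite -(IH false).
Qed.

Lemma bit_sums_last (h : int) s : bit h -> bit_sums h s -> bit (h + \sum_(x <- s) x).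
Proof.
elim: s h => [|t s IH] h hb /=; first by rewrite big_nil addr0.
by case/and3P=> _ b1 rs; rewrite big_cons addrA; exact: IH.
Qed.

Lemma entries_nonzeros s y l : entries s -> nonzeros s = y :: l -> y = 1 \/ y = -1.
Proof.
move=> ss E; have : y \in nonzeros s by rewrite E mem_head.
rewrite mem_filter => /andP[y0 /(allP ss)]; rewrite !inE => /or3P[] /eqP; [|by left|by right].
by move=> E'; rewrite E' in y0.
Qed.

Lemma alternating_column s : entries s ->
  alternating s && (if ohead (nonzeros s) is Some x then x == 1 else true) = bit_sums 0 s.
Proof.
move=> ss; rewrite -(path_bit_sums false ss) /alternating.
case E: (nonzeros s) => [|y l] //=.
by case: (entries_nonzeros ss E) => ->; rewrite /= ?andbT ?andbF.
Qed.

(** If the first nonzero entry were -1, the partial sums started from 1 would stay in {0, 1}; but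
    with total 1 the last of them is 2. *)
Lemma alternating_row s : entries s ->
  alternating s && (\sum_(x <- s) x == 1) = bit_sums 0 s && (\sum_(x <- s) x == 1).
Proof.
move=> ss; case: (eqVneq (\sum_(x <- s) x) 1) => [E|]; rewrite ?andbF // !andbT.
rewrite -(path_bit_sums false ss) /alternating.
case En: (nonzeros s) => [|y l] //=.
case: (entries_nonzeros ss En) => Ey; rewrite Ey //=.
apply/negbTE/negP => pl; have : bit_sums 1 s by rewrite -(path_bit_sums true ss) En Ey.
by move/(@bit_sums_last 1 s isT); rewrite E.
Qed.

Section Lines.
Variables (P : finType) (r : rel P) (T : P -> int).
Hypotheses (r_irr : irreflexive r) (r_asym : forall p p', r p p' -> r p' p = false).

Lemma bit_sums_pairwise h line : pairwise r line ->
  bit_sums h (map T line) =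
  all (fun p => bit (h + \sum_(p' <- line | r p' p) T p') && bit (h + \sum_(p' <- line | r p' p) T p' + T p)) line.
Proof.
elim: line h => [|p line IH] h //= /andP[/allP pl wl]; rewrite IH // andbA.
have lp p' : p' \in p :: line -> r p' p = false by rewrite inE => /orP[/eqP ->|/pl /r_asym].
have -> : \sum_(p' <- p :: line | r p' p) T p' = 0.
  by rewrite big1_seq // => p' /andP[rp /lp]; rewrite rp.
rewrite addr0.
by congr (_ && _); apply: eq_in_all => p' /pl pp'; rewrite !big_cons pp' !addrA.
Qed.

Lemma sum_line (C Q : pred P) line : uniq line -> (forall p, (p \in line) = C p) ->
  \sum_(p <- line | Q p) T p = \sum_(p | C p && Q p) T p.
Proof.
move=> ul mem; rewrite big_mkcond big_uniq // [RHS]big_mkcondr.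
by apply: eq_bigl => p; rewrite mem.
Qed.

Lemma bit_sums_line (C : pred P) line : pairwise r line -> (forall p, (p \in line) = C p) ->
  bit_sums 0 (map T line) =
  [forall p, C p ==> bit (\sum_(p' | C p' && r p' p) T p') && bit (\sum_(p' | C p' && r p' p) T p' + T p)].
Proof.
move=> wl mem; have ul := pairwise_uniq r_irr wl; rewrite bit_sums_pairwise //.
apply/allP/forallP => [H p|H p pl].
  by apply/implyP; rewrite -mem => /H; rewrite !add0r (sum_line _ ul mem).
by have := H p; rewrite -mem pl !add0r (sum_line _ ul mem).
Qed.
End Lines.

Lemma cardz (P : finType) (A : {set P}) : (#|A|)%:Z = \sum_p (p \in A)%:Z.
Proof.
rewrite -sum1_card big_mkcond (big_morph Posz PoszD (erefl 0%:Z)).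
by apply: eq_bigr => p _; case: (p \in A).
Qed.

Section Weight.
Variables (K : fieldType) (b c : K) (P : finType) (V H : P -> int) (T : P -> entry).

Lemma prod_cell_wt :
  \prod_p cell_wt b c (V p) (H p) (T p) =
  if [forall p, [&& bit (V p), bit (V p + T p), bit (H p) & bit (H p + T p)]]
  then b ^+ #|[set p | ((T p : int) == 0) && (V p == H p)]| * c ^+ #|[set p | (T p : int) != 0]| else 0.
Proof.
case: forallP => [ok|/forallP]; last first.
  by rewrite negb_forall => /existsP[p /negPf Hp]; rewrite (bigD1 p) //= /cell_wt Hp mul0r.
under eq_bigr => p _ do rewrite /cell_wt ok.
have e (x : K) (A : {set P}) : x ^+ #|A| = \prod_p (if p \in A then x else 1).
  by rewrite -big_mkcond prodr_const.
rewrite !e -big_split; apply: eq_bigr => p _ /=; rewrite !inE.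
by case: (_ == 0); case: (_ == _); rewrite ?mulr1 ?mul1r.
Qed.

Lemma entry_cases (t : entry) : [\/ (t : int) = 0, (t : int) = 1 | (t : int) = -1].
Proof.
have := ssvalP t; rewrite -[ssval t]/(t : int) !inE.
by case/or3P => /eqP ->; [apply: Or31|apply: Or32|apply: Or33].
Qed.

(** Entrywise, |t| = t + 2 [t = -1]. With row sums 1, the exponent of [c] thus counts the -1's. *)
Lemma card_nonzero :
  (#|[set p | (T p : int) != 0]|)%:Z = \sum_p (T p : int) + (2 * #|[set p | (T p : int) == -1]|)%:Z.
Proof.
rewrite PoszM !cardz big_distrr -big_split; apply: eq_bigr => p _ /=; rewrite !inE.
by case: (entry_cases (T p)) => ->.
Qed.
End Weight.

(** * Triangles and matrices *)

Section Transfer.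
Variables (K : fieldType) (b c : K) (P : finType) (row col : P -> nat) (n : nat).

Definition rows1 (H : nat -> int) := all (fun i => H i == 1) (iota 0 n).
Definition final_ast (V H : nat -> int) : K := if rows1 H then 1 else 0.
Definition final_dw m (V H : nat -> int) : K := if rows1 H && all (fun j => V j == 1) (iota 0 m) then 1 else 0.

Lemma rows1_ext H H' : H =1 H' -> rows1 H = rows1 H'.
Proof. by move=> HH; apply: eq_all => i; rewrite HH. Qed.

Lemma final_ast_ext V V' H H' : V =1 V' -> H =1 H' -> final_ast V H = final_ast V' H'.
Proof. by move=> _ /rows1_ext HH; rewrite /final_ast HH. Qed.

Lemma final_dw_ext m V V' H H' : V =1 V' -> H =1 H' -> final_dw m V H = final_dw m V' H'.
Proof.
move=> VV /rows1_ext HH; rewrite /final_dw HH; congr (if _ && _ then _ else _).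
by apply: eq_all => i; rewrite VV.
Qed.

Lemma rows1_false H i : (i < n)%N -> H i != 1 -> rows1 H = false.
Proof. by move=> i_n; apply: contraNF => /allP; apply; rewrite mem_iota. Qed.

Hypothesis row_col_inj : forall p p', row p = row p' -> col p = col p' -> p = p'.
Notation cells := (cells row col).

Let later i k := flatten [seq cells i' | i' <- iota i.+1 k].

Let all_cells_row i : all (fun p => row p == i) (cells i).
Proof. by apply/allP => p; rewrite mem_cells. Qed.

Let all_later i k : all (fun p => row p != i) (later i k).
Proof.
apply/allP => p /flattenP[l /mapP[i' ii' ->]]; rewrite mem_cells => /eqP ->.
by move: ii'; rewrite mem_iota; lia.
Qed.

Let rows_upd (H : nat -> int) i : (forall i', (i <= i')%N -> H i' = 0) -> (forall i', (i' < i)%N -> H i' = 1) ->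
  (forall i', (i < i')%N -> upd H i 1 i' = 0) /\ (forall i', (i' < i.+1)%N -> upd H i 1 i' = 1).
Proof.
move=> H0 H1; split=> i' ii'; rewrite /upd; case: eqP => E //; first by lia.
  by apply: H0; lia.
by apply: H1; lia.
Qed.

Lemma cell_sum_ast :
  (forall i, i < n -> map col (cells i) = iota i (n - i).*2.-1)%N ->
  cell_sum b c row col final_ast (all_cells row col n) (fun _ => 0) (fun _ => 0) = hom_ast 1 b c n (nseq n.*2.-1 false).
Proof.
move=> cols.
(* Invariant before row [i], with [k] rows to go: finished rows have sum 1, the others 0, and only
   the sums of columns that reach row [i] matter. *)
suff H k i V (H : nat -> int) s : (i + k)%N = n ->
    (forall i', (i <= i')%N -> H i' = 0) -> (forall i', (i' < i)%N -> H i' = 1) ->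
    [seq V j | j <- iota i k.*2.-1] = [seq (v : bool)%:Z | v <- s] ->
    cell_sum b c row col final_ast (flatten [seq cells i' | i' <- iota i k]) V H = hom_ast 1 b c k s.
  apply: H => //; rewrite map_nseq; apply: (@eq_from_nth _ 0); rewrite !size_map !size_iota ?size_nseq // => j jn.
  by rewrite (nth_map 0%N) ?size_iota // nth_nseq jn.
elim: k i V H s => [|k IH] i V H s ik H0 H1 VE /=.
  rewrite /final_ast ifT //; apply/allP => i'; rewrite mem_iota /= add0n => i'n; rewrite H1 //; lia.
have i_n : (i < n)%N by lia.
have ci : map col (cells i) = iota i k.*2.+1 by rewrite cols //; congr iota; lia.
have ss : size s = k.*2.+1 by move: (congr1 size VE); rewrite !size_map size_iota.
rewrite (@cell_sum_row K b c P row col _ final_ast_ext i (cells i) (later i k) V H false s) //; first last.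
- by rewrite H0.
- by rewrite map_comp ci.
- exact: cells_uniq.
(* A row that ends with sum 0 is discarded at once by [hom_ast]. In [cell_sum] it is [final_ast]
   that vanishes, since no later cell lies in this row. *)
apply: hom_row_ext => -[] o so; last first.
  apply: (@cell_sum_eq0 _ _ _ _ _ _ _ _ _ _ i) => // [V' H' /(rows1_false i_n)|]; first by rewrite /final_ast => ->.
  by rewrite /upd eqxx.
have [H0' H1'] := rows_upd H0 H1.
apply: IH => //; first by lia.
have VE' := @map_updl V (map col (cells i)) o (cells_uniq row_col_inj i).
rewrite size_map in VE'.
have sc : size (cells i) = k.*2.+1 by rewrite -(size_map col) ci size_iota.
rewrite sc so ss in VE'; have {VE'} := VE' erefl.
set V' := updl _ _ _; rewrite ci => VE'.
rewrite /trim so ss /= -behead_map map_take -VE' -map_take behead_map; congr map.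
by rewrite take_iota (minn_idPl (leqnSn _)); case: (k.*2).
Qed.

Lemma cell_sum_dw m :
  (forall i, i < n -> map col (cells i) = iota 0 m)%N ->
  cell_sum b c row col (final_dw m) (all_cells row col n) (fun _ => 0) (fun _ => 0) = hom_dw 1 b c n (nseq m false).
Proof.
move=> cols.
suff H k i V (H : nat -> int) s : (i + k)%N = n ->
    (forall i', (i <= i')%N -> H i' = 0) -> (forall i', (i' < i)%N -> H i' = 1) ->
    [seq V j | j <- iota 0 m] = [seq (v : bool)%:Z | v <- s] ->
    cell_sum b c row col (final_dw m) (flatten [seq cells i' | i' <- iota i k]) V H = hom_dw 1 b c k s.
  apply: H => //; rewrite map_nseq; apply: (@eq_from_nth _ 0); rewrite !size_map !size_iota ?size_nseq // => j jn.
  by rewrite (nth_map 0%N) ?size_iota // nth_nseq jn.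
elim: k i V H s => [|k IH] i V H s ik H0 H1 VE /=.
  rewrite /final_dw; have -> : rows1 H.
    by apply/allP => i'; rewrite mem_iota /= add0n => i'n; rewrite H1 //; lia.
  have -> : all (fun j => V j == 1) (iota 0 m) = all id s; last by [].
  by rewrite -(all_map V (fun v => v == 1)) VE all_map; apply: eq_all => -[].
have i_n : (i < n)%N by lia.
have ci := cols _ i_n.
have ss : size s = m by move: (congr1 size VE); rewrite !size_map size_iota.
rewrite (@cell_sum_row K b c P row col _ (@final_dw_ext m) i (cells i) (later i k) V H false s) //; first last.
- by rewrite H0.
- by rewrite map_comp ci.
- exact: cells_uniq.
apply: hom_row_ext => -[] o so; last first.
  apply: (@cell_sum_eq0 _ _ _ _ _ _ _ _ _ _ i) => // [V' H' /(rows1_false i_n)|]; first by rewrite /final_dw => ->.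
  by rewrite /upd eqxx.
have [H0' H1'] := rows_upd H0 H1.
apply: IH => //; first by lia.
by rewrite -ci map_updl ?cells_uniq // ci size_iota so ss.
Qed.
End Transfer.

(** * Partial sums and statistics of alternating sign triangles *)

Section Triangles.
Variable n : nat.
Notation m := n.*2.-1.
Notation P := (position n).

Definition rowN (p : P) : nat := row_of p.
Definition colN (p : P) : nat := col_of p.

Lemma rowN_lt p : (rowN p < n)%N. Proof. exact: ltn_ord. Qed.

Lemma rowN_colN_inj p p' : rowN p = rowN p' -> colN p = colN p' -> p = p'.
Proof.
move=> /val_inj E /val_inj E'; apply: val_inj.
by rewrite (surjective_pairing (val p)) (surjective_pairing (val p')); congr pair.
Qed.

Lemma positionP i j : reflect (exists2 p : P, rowN p = i & colN p = j)
  [&& i < n, i <= j & i + j < m]%N.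
Proof.
apply: (iffP and3P) => [[i_n ij ijm]|[p <- <-]]; last first.
  by split; [exact: rowN_lt | case/andP: (valP p) | case/andP: (valP p)].
have jm : (j < m)%N by lia.
have ok : (fun p : 'I_n * 'I_m => (p.1 <= p.2)%N && (p.1 + p.2 < m)%N) (Ordinal i_n, Ordinal jm).
  by rewrite /= ij.
by exists (Sub (Ordinal i_n, Ordinal jm) ok : P); rewrite /rowN /colN /row_of /col_of SubK.
Qed.

Lemma cells_triangle i : (i < n)%N -> map colN (cells rowN colN i) = iota i (n - i).*2.-1.
Proof.
move=> i_n; apply: map_col_cells => [|j]; first exact: rowN_colN_inj.
have -> : (j \in iota i (n - i).*2.-1) = [&& i < n, i <= j & i + j < m]%N; last exact: positionP.
by rewrite mem_iota i_n /=; lia.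
Qed.

Definition tri_row (i : 'I_n) : seq P := pmap insub [seq (i, j) | j : 'I_m].
Definition tri_col (j : 'I_m) : seq P := pmap insub [seq (i, j) | i : 'I_n].

Lemma mem_tri_row i p : (p \in tri_row i) = (row_of p == i).
Proof.
rewrite mem_pmap_sub; apply/mapP/eqP => [[j _ E]|<-]; first by rewrite /row_of E.
by exists (col_of p); rewrite ?mem_enum // [LHS]surjective_pairing.
Qed.

Lemma mem_tri_col j p : (p \in tri_col j) = (col_of p == j).
Proof.
rewrite mem_pmap_sub; apply/mapP/eqP => [[i _ E]|<-]; first by rewrite /col_of E.
by exists (row_of p); rewrite ?mem_enum // [LHS]surjective_pairing.
Qed.

Lemma pairwise_ord k : pairwise (fun i j : 'I_k => i < j)%N (enum 'I_k).
Proof.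
have := iota_ltn_sorted 0 k; rewrite (sorted_pairwise ltn_trans) -val_enum_ord pairwise_map.
by [].
Qed.

Lemma pairwise_pmap (r : rel ('I_n * 'I_m)) s :
  pairwise r s -> pairwise (fun p p' : P => r (val p) (val p')) (pmap insub s).
Proof.
move=> rs; rewrite -(pairwise_map val) (pmap_filter (insubK _)).
exact: pairwise_filter.
Qed.

Lemma pairwise_tri_row i : pairwise (fun p p' => colN p < colN p')%N (tri_row i).
Proof.
apply: (@pairwise_pmap (fun p p' => p.2 < p'.2)%N); rewrite pairwise_map.
exact: pairwise_ord.
Qed.

Lemma pairwise_tri_col j : pairwise (fun p p' => rowN p < rowN p')%N (tri_col j).
Proof.
apply: (@pairwise_pmap (fun p p' => p.1 < p'.1)%N); rewrite pairwise_map.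
exact: pairwise_ord.
Qed.

Variable T : triangle n.
Definition above p : int := \sum_(p' | (rowN p' < rowN p)%N && (colN p' == colN p)) (T p' : int).
Definition before p : int := \sum_(p' | (rowN p' == rowN p) && (colN p' < colN p)%N) (T p' : int).

Lemma entries_map (s : seq P) : entries [seq (T p : int) | p <- s].
Proof. by apply/allP => _ /mapP[p _ ->]; exact: ssvalP. Qed.

Let lt_irr (f : P -> nat) : irreflexive (fun p p' => f p < f p')%N.
Proof. by move=> p; rewrite ltnn. Qed.

Let lt_asym (f : P -> nat) p p' : (f p < f p')%N -> (f p' < f p)%N = false.
Proof. by lia. Qed.

Lemma bit_sums_row i : bit_sums 0 (row_entries T i) =
  [forall p, (row_of p == i) ==> bit (before p) && bit (before p + T p)].
Proof.
rewrite /row_entries -/(tri_row i) (bit_sums_line _ (lt_irr colN) (@lt_asym colN) (pairwise_tri_row i) (mem_tri_row i)).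
by apply: eq_forallb => p; case: eqP => //= <-; rewrite /before.
Qed.

Lemma bit_sums_col j : bit_sums 0 (col_entries T j) =
  [forall p, (col_of p == j) ==> bit (above p) && bit (above p + T p)].
Proof.
rewrite /col_entries -/(tri_col j) (bit_sums_line _ (lt_irr rowN) (@lt_asym rowN) (pairwise_tri_col j) (mem_tri_col j)).
apply: eq_forallb => p; case: eqP => //= <-; rewrite /above.
by congr (bit _ && bit (_ + _)); apply: eq_bigl => p'; rewrite andbC.
Qed.

Definition triangle_ok := [forall p, [&& bit (above p), bit (above p + T p), bit (before p) & bit (before p + T p)]].

Lemma sum_row_entries i : \sum_(x <- row_entries T i) x = \sum_(p | rowN p == i) (T p : int).
Proof.
rewrite big_map (@sum_line P (fun p => (T p : int)) _ predT _ (pairwise_uniq (lt_irr colN) (pairwise_tri_row i)) (mem_tri_row i)).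
by apply: eq_bigl => p; rewrite andbT.
Qed.

Lemma is_ASTE : is_AST T = triangle_ok && rows1 n (fun i => \sum_(p | rowN p == i) (T p : int)).
Proof.
have -> : is_AST T = [forall i, bit_sums 0 (row_entries T i) && (\sum_(x <- row_entries T i) x == 1)] &&
    [forall j, bit_sums 0 (col_entries T j)].
  apply/and4P/andP => [[/forallP r1 /forallP c1 /forallP r2 /forallP c2]|[/forallP R /forallP C]].
    split; apply/forallP => i.
      by rewrite -alternating_row ?entries_map // r1 r2.
    by rewrite -alternating_column ?entries_map // c1 c2.
  split; apply/forallP => i.
  - by have := R i; rewrite -alternating_row ?entries_map // => /andP[].
  - by have := C i; rewrite -alternating_column ?entries_map // => /andP[].
  - by have := R i => /andP[].
  - by have := C i; rewrite -alternating_column ?entries_map // => /andP[].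
apply/andP/andP => [[/forallP R /forallP C]|[/forallP ok /allP r1]]; split.
- apply/forallP => p; have /andP[Rp _] := R (row_of p); have Cp := C (col_of p).
  rewrite bit_sums_row in Rp; rewrite bit_sums_col in Cp.
  move/forallP/(_ p): Rp; move/forallP/(_ p): Cp; rewrite !eqxx /= => /andP[-> ->] /andP[-> ->] //.
- apply/allP => i; rewrite mem_iota /= add0n => i_n; have /andP[_] := R (Ordinal i_n).
  by rewrite sum_row_entries.
- apply/forallP => i; rewrite bit_sums_row sum_row_entries r1 ?mem_iota ?ltn_ord // andbT.
  by apply/forallP => p; case/and4P: (ok p) => _ _ -> ->; rewrite implybT.
- apply/forallP => j; rewrite bit_sums_col.
  by apply/forallP => p; case/and4P: (ok p) => -> -> _ _; rewrite implybT.
Qed.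

Lemma sum_aboveE p : sum_above T p = above p.
Proof. by apply: eq_bigl => p'; rewrite andbC. Qed.

(** [sum_left] includes the cell itself and [before] does not; the two agree at the zeros that [SW]
    and [NE] count. *)
Lemma sum_leftE p : sum_left T p = before p + T p.
Proof.
rewrite /sum_left (bigD1 p) /=; last by rewrite eqxx leqnn.
rewrite addrC; congr (_ + _); apply: eq_bigl => p'.
apply/idP/idP => [/andP[/andP[/eqP E le_c] ne]|/andP[/eqP E lt_c]].
  rewrite /rowN E eqxx ltn_neqAle le_c andbT /=; apply: contra_neq ne => E2.
  by apply: rowN_colN_inj; rewrite // /rowN E.
rewrite -val_eqE /= [val _]E eqxx (ltnW lt_c) /=.
by apply: contraTneq lt_c => ->; rewrite ltnn.
Qed.

Lemma card_SW_NE : triangle_ok ->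
  #|[set p | ((T p : int) == 0) && (above p == before p)]| = (#|SW T| + #|NE T|)%N.
Proof.
move/forallP => ok; have -> : [set p | ((T p : int) == 0) && (above p == before p)] = SW T :|: NE T.
  apply/setP => p; rewrite !inE sum_aboveE sum_leftE; case: eqP => //= ->; rewrite addr0.
  by case/and4P: (ok p); rewrite /bit => /orP[] /eqP -> _ /orP[] /eqP ->.
rewrite cardsU (_ : SW T :&: NE T = set0) ?cards0 ?subn0 //.
apply/setP => p; rewrite !inE; case: (_ == 0) => //=.
by case: eqP => // ->; rewrite andbF.
Qed.

Lemma card_nonzero_AST : rows1 n (fun i => \sum_(p | rowN p == i) (T p : int)) ->
  #|[set p | (T p : int) != 0]| = (n + 2 * mu_nabla T)%N.
Proof.
move=> r1; apply/eqP; rewrite -eqz_nat card_nonzero PoszD; apply/eqP; congr (_ + _).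
rewrite (partition_big (fun p : P => row_of p) predT) //=.
rewrite (eq_bigr (fun _ => 1)) => [|i _]; last first.
  by apply/eqP; move/allP: r1 => /(_ i); rewrite mem_iota ltn_ord; exact.
by rewrite sumr_const card_ord natz.
Qed.
End Triangles.

Section Sum.
Variables (K : fieldType) (b c : K).

Lemma hom_astE n : hom_ast 1 b c n (nseq n.*2.-1 false) =
  \sum_(T in AST n) b ^+ (#|SW T| + #|NE T|) * c ^+ (n + 2 * mu_nabla T).
Proof.
have cols i : (i < n)%N -> map (@colN n) (cells (@rowN n) (@colN n) i) = iota i (n - i).*2.-1 := @cells_triangle n i.
rewrite -(cell_sum_ast b c (@rowN_colN_inj n) cols).
rewrite (cell_sum_all_cells b c (@final_ast_ext K n) (@rowN_lt n) (@rowN_colN_inj n)).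
rewrite [RHS]big_mkcond; apply: eq_bigr => T _.
rewrite (prod_cell_wt b c (above T) (before T) T) inE is_ASTE -/(triangle_ok T) /final_ast.
case: ifP => ok; case: ifP => r1; rewrite ?mulr1 ?mul0r ?mulr0 //=.
by rewrite card_SW_NE // card_nonzero_AST.
Qed.
End Sum.

(** * Partial sums and inversions of alternating sign matrices *)

Section Matrices.
Variable n : nat.
Notation P := ('I_n * 'I_n)%type.

Definition rowM (p : P) : nat := p.1.
Definition colM (p : P) : nat := p.2.

Lemma rowM_lt p : (rowM p < n)%N. Proof. exact: ltn_ord. Qed.

Lemma rowM_colM_inj p p' : rowM p = rowM p' -> colM p = colM p' -> p = p'.
Proof. by case: p p' => i j [i' j'] /val_inj /= -> /val_inj /= ->. Qed.

Lemma cells_square i : (i < n)%N -> map colM (cells rowM colM i) = iota 0 n.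
Proof.
move=> i_n; apply: map_col_cells => [|j]; first exact: rowM_colM_inj.
rewrite mem_iota /= add0n; apply: (iffP idP) => [jn|[p _ <-]]; last exact: ltn_ord.
by exists (Ordinal i_n, Ordinal jn).
Qed.

Variable A : 'M[entry]_n.
Let T (p : P) : entry := A p.1 p.2.
Definition aboveM p : int := \sum_(p' | (rowM p' < rowM p)%N && (colM p' == colM p)) (T p' : int).
Definition beforeM p : int := \sum_(p' | (rowM p' == rowM p) && (colM p' < colM p)%N) (T p' : int).

Let row_lineM i : seq P := [seq (i, j) | j : 'I_n].
Let col_lineM j : seq P := [seq (i, j) | i : 'I_n].

Let lt_irr (f : P -> nat) : irreflexive (fun p p' => f p < f p')%N.
Proof. by move=> p; rewrite ltnn. Qed.

Let lt_asym (f : P -> nat) p p' : (f p < f p')%N -> (f p' < f p)%N = false.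
Proof. by lia. Qed.

Let mem_row_lineM i p : (p \in row_lineM i) = (p.1 == i).
Proof.
apply/mapP/eqP => [[j _ ->]|<-] //.
by exists p.2; rewrite ?mem_enum // [LHS]surjective_pairing.
Qed.

Let mem_col_lineM j p : (p \in col_lineM j) = (p.2 == j).
Proof.
apply/mapP/eqP => [[i _ ->]|<-] //.
by exists p.1; rewrite ?mem_enum // [LHS]surjective_pairing.
Qed.

Let pairwise_row_lineM i : pairwise (fun p p' => colM p < colM p')%N (row_lineM i).
Proof. by rewrite pairwise_map; exact: pairwise_ord. Qed.

Let pairwise_col_lineM j : pairwise (fun p p' => rowM p < rowM p')%N (col_lineM j).
Proof. by rewrite pairwise_map; exact: pairwise_ord. Qed.

Let entries_mapM (s : seq P) : entries [seq (T p : int) | p <- s].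
Proof. by apply/allP => _ /mapP[p _ ->]; exact: ssvalP. Qed.

Let row_mapE i : [seq (A i j : int) | j : 'I_n] = [seq (T p : int) | p <- row_lineM i].
Proof. by rewrite -map_comp. Qed.

Let col_mapE j : [seq (A i j : int) | i : 'I_n] = [seq (T p : int) | p <- col_lineM j].
Proof. by rewrite -map_comp. Qed.

Let bit_sums_rowM i : bit_sums 0 [seq (A i j : int) | j : 'I_n] =
  [forall p : P, (p.1 == i) ==> bit (beforeM p) && bit (beforeM p + T p)].
Proof.
rewrite row_mapE (bit_sums_line _ (lt_irr colM) (@lt_asym colM) (pairwise_row_lineM i) (mem_row_lineM i)).
by apply: eq_forallb => p; case: eqP => //= <-.
Qed.

Let bit_sums_colM j : bit_sums 0 [seq (A i j : int) | i : 'I_n] =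
  [forall p : P, (p.2 == j) ==> bit (aboveM p) && bit (aboveM p + T p)].
Proof.
rewrite col_mapE (bit_sums_line _ (lt_irr rowM) (@lt_asym rowM) (pairwise_col_lineM j) (mem_col_lineM j)).
apply: eq_forallb => p; case: eqP => //= <-.
by congr (bit _ && bit (_ + _)); apply: eq_bigl => p'; rewrite andbC.
Qed.

Definition square_ok := [forall p, [&& bit (aboveM p), bit (aboveM p + T p), bit (beforeM p) & bit (beforeM p + T p)]].

Let rowsumE i : \sum_(p : P | rowM p == i) (T p : int) = \sum_(i' : 'I_n | i' == i :> nat) \sum_j (A i' j : int).
Proof. by rewrite pair_big /=; apply: eq_bigl => p; rewrite andbT. Qed.

Let colsumE j : \sum_(p : P | colM p == j) (T p : int) = \sum_(j' : 'I_n | j' == j :> nat) \sum_i (A i j' : int).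
Proof.
rewrite exchange_big pair_big /=; apply: eq_big => [p|//]; by [].
Qed.

Definition sums1 := [forall i, \sum_j (A i j : int) == 1] && [forall j, \sum_i (A i j : int) == 1].

Lemma sums1E : rows1 n (fun i => \sum_(p : P | rowM p == i) (T p : int)) &&
  all (fun j => \sum_(p : P | colM p == j) (T p : int) == 1) (iota 0 n) = sums1.
Proof.
have one (i : 'I_n) (f : 'I_n -> int) : \sum_(i' : 'I_n | i' == i :> nat) f i' = f i.
  by rewrite (big_pred1 i).
congr (_ && _); apply/allP/forallP => H i.
- by have := H i; rewrite mem_iota ltn_ord rowsumE one; exact.
- by rewrite mem_iota /= add0n => i_n; rewrite rowsumE (one (Ordinal i_n)).
- by have := H i; rewrite mem_iota ltn_ord colsumE one; exact.
- by rewrite mem_iota /= add0n => i_n; rewrite colsumE (one (Ordinal i_n)).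
Qed.

Lemma is_ASME : is_ASM A = square_ok && sums1.
Proof.
have -> : is_ASM A = [forall i, bit_sums 0 [seq (A i j : int) | j : 'I_n] && (\sum_j (A i j : int) == 1)] &&
    [forall j, bit_sums 0 [seq (A i j : int) | i : 'I_n] && (\sum_i (A i j : int) == 1)].
  have E1 i : \sum_j (A i j : int) = \sum_(x <- [seq (A i j : int) | j : 'I_n]) x by rewrite big_map big_enum.
  have E2 j : \sum_i (A i j : int) = \sum_(x <- [seq (A i j : int) | i : 'I_n]) x by rewrite big_map big_enum.
  congr (_ && _); apply: eq_forallb => i.
    by rewrite E1 row_mapE alternating_row.
  by rewrite E2 col_mapE alternating_row.
apply/andP/and3P => [[/forallP R /forallP C]|[/forallP ok /forallP R /forallP C]]; split.
- apply/forallP => p; have /andP[Rp _] := R p.1; have /andP[Cp _] := C p.2.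
  rewrite bit_sums_rowM in Rp; rewrite bit_sums_colM in Cp.
  by move/forallP/(_ p): Rp; move/forallP/(_ p): Cp; rewrite !eqxx /= => /andP[-> ->] /andP[-> ->].
- by apply/forallP => i; case/andP: (R i).
- by apply/forallP => i; case/andP: (C i).
- apply/forallP => i; rewrite bit_sums_rowM R andbT.
  by apply/forallP => p; case/and4P: (ok p) => _ _ -> ->; rewrite implybT.
- apply/forallP => j; rewrite bit_sums_colM C andbT.
  by apply/forallP => p; case/and4P: (ok p) => -> -> _ _; rewrite implybT.
Qed.

Let aboveE i j : aboveM (i, j) = \sum_(i' : 'I_n | (i' < i)%N) (A i' j : int).
Proof.
rewrite /aboveM /T -(pair_big (fun i' : 'I_n => i' < i)%N (fun j' : 'I_n => j' == j :> nat) (fun i j => A i j : int)) /=.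
by apply: eq_bigr => i' _; rewrite (big_pred1 j).
Qed.

Let beforeE i j : beforeM (i, j) + A i j = \sum_(j' : 'I_n | (j' <= j)%N) (A i j' : int).
Proof.
rewrite /beforeM /T -(pair_big (fun i' : 'I_n => i' == i :> nat) (fun j' : 'I_n => j' < j)%N (fun i j => A i j : int)) /=.
rewrite (big_pred1 i) // [RHS](bigD1 j) //= addrC; congr (_ + _); apply: eq_bigl => j'.
by rewrite ltn_neqAle andbC.
Qed.

Definition swM := [set p | [&& (T p : int) == 0, aboveM p == 1 & beforeM p == 1]].
Definition neM := [set p | [&& (T p : int) == 0, aboveM p == 0 & beforeM p == 0]].

Let ok_cases p : square_ok ->
  [\/ [/\ (T p : int) = 0, aboveM p = 0 \/ aboveM p = 1 & beforeM p = 0 \/ beforeM p = 1],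
      [/\ (T p : int) = 1, aboveM p = 0 & beforeM p = 0] |
      [/\ (T p : int) = -1, aboveM p = 1 & beforeM p = 1] ].
Proof.
have bitP v : bit v -> v = 0 \/ v = 1 by case/orP => /eqP; auto.
move/forallP/(_ p); case: (entry_cases (T p)) => ET; rewrite ET => /and4P[/bitP Ha + /bitP Hh +].
- by move=> _ _; apply: Or31.
- by case: Ha Hh => -> [] -> // _ _; apply: Or32.
- by case: Ha Hh => -> [] -> // _ _; apply: Or33.
Qed.

(** Grouped by (i, j), the double sum is the column sum above times the row sum up to the cell. The
    first factor is 0 at a 1, the second at a -1, so exactly the zeros with both sums 1
    contribute. *)
Lemma inv_ASME : square_ok -> inv_ASM A = (#|swM|)%:Z.
Proof.
move=> ok; have -> : inv_ASM A = \sum_p aboveM p * (beforeM p + T p).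
  rewrite -(pair_bigA _ (fun i j => aboveM (i, j) * (beforeM (i, j) + A i j))) /=.
  apply: eq_bigr => i _; rewrite exchange_big; apply: eq_bigr => j _ /=.
  by rewrite aboveE beforeE big_distrl; apply: eq_bigr => i' _; rewrite big_distrr.
rewrite cardz; apply: eq_bigr => p _; rewrite inE.
by case: (ok_cases p ok) => -[-> ]; [move=> [] -> [] ->|move=> -> ->|move=> -> ->].
Qed.

(** Cell by cell, 1 minus the two sums is 1 on [neM], -1 on [swM] and 0 elsewhere. Its total is n^2
    minus the sum of i + (i + 1) over i < n, that is 0. *)
Lemma card_swM_neM : square_ok -> sums1 -> #|swM| = #|neM|.
Proof.
move=> ok /andP[/forallP R /forallP C].
have E : (#|neM|)%:Z - (#|swM|)%:Z = \sum_(p : P) (1 - aboveM p - (beforeM p + T p)).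
  rewrite !cardz -sumrB; apply: eq_bigr => p _; rewrite !inE.
  by case: (ok_cases p ok) => -[-> ]; [move=> [] -> [] ->|move=> -> ->|move=> -> ->].
have count (k : nat) : (k <= n)%N -> \sum_(i' < n | (i' < k)%N) (1 : int) = k%:Z.
  by move=> kn; rewrite -(big_ord_widen n (fun _ => 1 : int) kn) sumr_const card_ord natz.
have Ea : \sum_(p : P) aboveM p = \sum_(i < n) (i : nat)%:Z.
  rewrite -(pair_bigA _ (fun i j => aboveM (i, j))) /=; apply: eq_bigr => i _.
  under eq_bigr do rewrite aboveE.
  rewrite exchange_big -[RHS](count i (ltnW (ltn_ord i))); apply: eq_bigr => i' _.
  exact/eqP.
have El : \sum_(p : P) (beforeM p + T p) = \sum_(j < n) (j.+1)%:Z.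
  rewrite -(pair_bigA _ (fun i j => beforeM (i, j) + A i j)) /= exchange_big; apply: eq_bigr => j _.
  under eq_bigr do rewrite beforeE.
  rewrite exchange_big -[RHS](count j.+1 (ltn_ord j)); apply: eq_bigr => j' _.
  exact/eqP.
have Z0 : \sum_(p : P) (1 - aboveM p - (beforeM p + T p)) = 0.
  rewrite !sumrB Ea El sumr_const card_prod card_ord natz.
  have -> : (n * n)%:Z = \sum_(i < n) (i + i.+1)%N%:Z.
    rewrite -(big_morph Posz PoszD (erefl 0%:Z)); congr Posz.
    by elim: (n) => [|k IH]; rewrite ?big_ord0 // big_ord_recr /= -IH; lia.
  rewrite -!sumrB big1 // => i _; rewrite PoszD; ring.
by apply/eqP; rewrite -eqz_nat eq_sym -subr_eq0 E Z0.
Qed.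

Lemma card_b_ASM : square_ok -> sums1 ->
  #|[set p | ((T p : int) == 0) && (aboveM p == beforeM p)]| = (2 * #|swM|)%N.
Proof.
move=> ok s1; have -> : [set p | ((T p : int) == 0) && (aboveM p == beforeM p)] = swM :|: neM.
  by apply/setP => p; rewrite !inE; case: (ok_cases p ok) => -[-> ]; [move=> [] -> [] ->|move=> -> ->|move=> -> ->].
rewrite cardsU (_ : swM :&: neM = set0) ?cards0 ?subn0 -?card_swM_neM // ?mul2n ?addnn //.
by apply/setP => p; rewrite !inE; case: (_ == 0) => //=; case: eqP => // ->; rewrite andbF.
Qed.

Lemma card_nonzero_ASM : sums1 -> #|[set p | (T p : int) != 0]| = (n + 2 * mu_ASM A)%N.
Proof.
case/andP=> /forallP R _; apply/eqP; rewrite -eqz_nat card_nonzero PoszD; apply/eqP; congr (_ + _).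
rewrite -(pair_bigA _ (fun i j => A i j : int)) /= (eq_bigr (fun _ => 1)) => [|i _]; last exact/eqP.
by rewrite sumr_const card_ord natz.
Qed.
End Matrices.

Section Sum.
Variables (K : fieldType) (b c : K).

Lemma hom_dwE n : hom_dw 1 b c n (nseq n false) =
  \sum_(A in ASM n) b ^+ (2 * #|swM A|) * c ^+ (n + 2 * mu_ASM A).
Proof.
rewrite -(cell_sum_dw b c (@rowM_colM_inj n) (@cells_square n)).
rewrite (cell_sum_all_cells b c (@final_dw_ext K n n) (@rowM_lt n) (@rowM_colM_inj n)).
pose h (A : 'M[entry]_n) : {ffun 'I_n * 'I_n -> entry} := [ffun p => A p.1 p.2].
rewrite (reindex h) /=; last first.
  exists (fun T : {ffun 'I_n * 'I_n -> entry} => \matrix_(i, j) T (i, j)) => [A _|T _].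
    by apply/matrixP => i j; rewrite mxE ffunE.
  by apply/ffunP => -[i j]; rewrite ffunE mxE.
rewrite [RHS]big_mkcond; apply: eq_bigr => A _.
have hE p : h A p = A p.1 p.2 by rewrite ffunE.
rewrite inE is_ASME; have -> : final_dw K n n (fun j => \sum_(p | colM p == j) (h A p : int))
    (fun i => \sum_(p | rowM p == i) (h A p : int)) = if sums1 A then 1 else 0.
  rewrite -sums1E; apply: final_dw_ext => k; by apply: eq_bigr => p _; rewrite hE.
rewrite (eq_bigr (fun p => cell_wt b c (aboveM A p) (beforeM A p) (A p.1 p.2))) => [|p _]; last first.
  by rewrite hE; congr cell_wt; apply: eq_bigr => p' _; rewrite hE.
rewrite (prod_cell_wt b c (aboveM A) (beforeM A)) -/(square_ok A).
case: ifP => ok; case: ifP => s1; rewrite ?mulr1 ?mul0r ?mulr0 //=.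
by rewrite card_b_ASM // card_nonzero_ASM.
Qed.
End Sum.

(** * Comparison of the generating functions *)

Lemma poly_eq_on_nat (K : idomainType) (f : nat -> K) (p p' : {poly K}) : injective f ->
  (forall i, p.[f i] = p'.[f i]) -> p = p'.
Proof.
move=> f_inj E; apply/eqP; rewrite -subr_eq0; apply: contraT => nz.
have := @max_poly_roots _ _ [seq f i | i <- iota 0 (size (p - p'))] nz.
rewrite size_map size_iota ltnn; apply; last by rewrite map_inj_uniq ?iota_uniq.
by apply/allP => _ /mapP[i _ ->]; rewrite /root hornerD hornerN E subrr.
Qed.

Lemma sum_expX_coef (K : nzRingType) (X : finType) (S : {set X}) (k : X -> K) (m : X -> nat) j :
  (\sum_(x in S) k x *: 'X^(m x))`_j = \sum_(x in S | m x == j) k x.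
Proof.
rewrite coef_sum big_mkcondr; apply: eq_bigr => x _.
by rewrite coefZ coefXn eq_sym; case: eqP; rewrite ?mulr1 ?mulr0.
Qed.

(** For fixed [i], the values [ga i j] separate the exponents [m]; then the values [be i] separate
    [k]. [ga] may depend on [i], as the weight of a nonzero entry depends on that of a b cell. *)
Lemma card_from_generating (K : numDomainType) (X Y : finType) (S : {set X}) (S' : {set Y})
    (k m : X -> nat) (k' m' : Y -> nat) (be : nat -> K) (ga : nat -> nat -> K) :
  injective be -> (forall i, injective (ga i)) ->
  (forall i j, \sum_(x in S) be i ^+ k x * ga i j ^+ m x = \sum_(y in S') be i ^+ k' y * ga i j ^+ m' y) ->
  forall a b, #|[set x in S | (m x == a) && (k x == b)]| = #|[set y in S' | (m' y == a) && (k' y == b)]|.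
Proof.
move=> be_inj ga_inj E a b.
have E1 i : \sum_(x in S | m x == a) be i ^+ k x = \sum_(y in S' | m' y == a) be i ^+ k' y.
  rewrite -(sum_expX_coef S (fun x => be i ^+ k x)) -(sum_expX_coef S' (fun y => be i ^+ k' y)).
  congr (polyseq _)`_a; apply: (poly_eq_on_nat (ga_inj i)) => j; rewrite !horner_sum.
  have := E i j; congr (_ = _); apply: eq_bigr => x _; by rewrite hornerZ hornerXn.
have E2 : \sum_(x in [set x in S | m x == a]) 1 *: 'X^(k x) = \sum_(y in [set y in S' | m' y == a]) 1 *: 'X^(k' y) :> {poly K}.
  apply: (poly_eq_on_nat be_inj) => i; rewrite !horner_sum.
  have := E1 i; congr (_ = _); (apply: eq_big => [x|x _]; first by rewrite inE); by rewrite hornerZ hornerXn mul1r.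
have := congr1 (fun p : {poly K} => p`_b) E2; rewrite !sum_expX_coef !sumr_const => /eqP.
rewrite eqr_nat => /eqP; congr (_ = _); apply: eq_card => x; by rewrite unfold_in /= !inE andbA.
Qed.

(* With b / a = [be], the ratio c / a satisfies (c / a)^2 = [ga2], because
   (a^2 + b^2 - c^2) / (a b) = - (q^2 + q^-2). *)
Section Point.
Variables (r k : nat).
Hypothesis r2 : (1 < r)%N.
Let q : algC := r%:R ^+ 2.
Let be : algC := k.+1%:R.
Let ga2 : algC := 1 + be ^+ 2 + be * (q ^+ 2 + q ^- 2).

(** With [q] the square of an integer above 1, a root of [q] is at hand and q^8 <> 1. [algC]
    contains the square roots that define [u], and the imaginary unit. *)
Lemma homogeneous_equality n :
  \sum_(T in AST n.+1) be ^+ (#|SW T| + #|NE T|) * ga2 ^+ mu_nabla T =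
  \sum_(A in ASM n.+1) be ^+ (2 * #|swM A|) * ga2 ^+ mu_ASM A.
Proof.
have rpos : (0 < r)%N by lia.
have q0 : q != 0 by rewrite expf_neq0 // pnatr_eq0; lia.
have qX j : q ^+ j.+1 != 1.
  have r1 : (1 < r ^ (2 * j.+1))%N by rewrite -[1%N](expn0 r) ltn_exp2l.
  by rewrite -exprM -natrX (eqr_nat _ _ 1%N) gtn_eqF.
have d0 : 1 + be * q ^+ 2 != 0.
  by rewrite /be /q -exprM -natrX -natrM -(natrD _ 1%N) pnatr_eq0.
have n0 : q ^+ 2 + be != 0.
  by rewrite /be /q -exprM -natrX -natrD pnatr_eq0; lia.
(* [z] is the product p common to all cells; clearing denominators in b = [be] a yields this value
   of z^2. *)
pose z : algC := sqrtC ((q ^+ 2 + be) / (1 + be * q ^+ 2)).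
have z2 : z ^+ 2 = (q ^+ 2 + be) / (1 + be * q ^+ 2) by rewrite sqrtCK.
have z0 : z != 0 by rewrite -sqrf_eq0 z2 mulf_neq0 ?invr_eq0.
pose u : algC := sqrtC z.
have uu : u * u = z by rewrite -expr2 sqrtCK.
have u0 : u != 0 by rewrite -sqrf_eq0 expr2 uu.
set a := weight_a q (u * u).
have a0 : a != 0.
  apply/eqP => /(sg_eq0 (mulf_neq0 q0 (mulf_neq0 u0 u0))); rewrite uu exprMn z2 => E.
  case/negP: (qX 3%N); apply/eqP.
  have E' : q ^+ 2 * (q ^+ 2 + be) = 1 + be * q ^+ 2.
    transitivity (q ^+ 2 * ((q ^+ 2 + be) / (1 + be * q ^+ 2)) * (1 + be * q ^+ 2)).
      by rewrite -mulrA divfK.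
    by rewrite E mul1r.
  have -> : q ^+ 4 = q ^+ 2 * (q ^+ 2 + be) - be * q ^+ 2 by ring.
  by rewrite E' addrK.
have bE : weight_b q (u * u) = be * a.
  have zE : z ^+ 2 * (1 + be * q ^+ 2) = q ^+ 2 + be by rewrite z2 divfK.
  rewrite /a uu /weight_a /weight_b /sg; apply: (mulIf (mulf_neq0 q0 z0)).
  transitivity (q ^+ 2 - z ^+ 2); first by field; rewrite q0 z0.
  transitivity (be * (q ^+ 2 * z ^+ 2 - 1)); last by field; rewrite q0 z0.
  apply/eqP; rewrite -subr_eq0.
  have -> : q ^+ 2 - z ^+ 2 - be * (q ^+ 2 * z ^+ 2 - 1) = q ^+ 2 + be - z ^+ 2 * (1 + be * q ^+ 2) by ring.
  by rewrite zE subrr.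
have cE : (weight_c q / a) ^+ 2 = ga2.
  rewrite exprMn exprVn; apply: (mulIf (expf_neq0 2 a0)); rewrite divfK ?expf_neq0 //.
  have -> : weight_c q ^+ 2 = a ^+ 2 + (weight_b q (u * u)) ^+ 2 + (q ^+ 2 + q ^- 2) * a * weight_b q (u * u).
    by rewrite /a uu /weight_a /weight_b /weight_c /sg; field; rewrite q0 z0.
  by rewrite bE /ga2; ring.
have c0 : weight_c q / a != 0.
  rewrite mulf_neq0 ?invr_eq0 //; apply/eqP => /(sg_eq0 (expf_neq0 2 q0)) /eqP.
  by rewrite -exprM (negPf (qX 3%N)).
have i2 : ('i : algC) ^+ 2 = -1 by rewrite sqrCi.
have := @ast_fun_dw_diag _ q u r%:R 'i q0 u0 (qX 7%N) (erefl _) i2 (nseq n u).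
rewrite all_nseq u0 orbT => /(_ isT).
rewrite ast_fun_hom // -[u :: _]/(nseq n.+1 u) dw_diag_hom -/a bE.
rewrite hom_ast_norm ?size_nseq // hom_dw_norm // size_nseq mulfK //.
move/(mulfI (expf_neq0 _ a0)); rewrite hom_astE hom_dwE.
(* Apart from the common power [n.+1], only even powers of c / a occur, so both sums depend on its
   square [ga2] alone. *)
have X j : (weight_c q / a) ^+ (n.+1 + 2 * j) = (weight_c q / a) ^+ n.+1 * ga2 ^+ j by rewrite exprD exprM cE.
move=> E; apply: (mulfI (expf_neq0 n.+1 c0)); rewrite !big_distrr /=.
move: E; congr (_ = _); apply: eq_bigr => T _; by rewrite X mulrCA.
Qed.
End Point.

Section Counting.
Let be (k : nat) : algC := k.+1%:R.
Let ga2 (k j : nat) : algC := 1 + be k ^+ 2 + be k * ((j.+2%:R ^+ 2) ^+ 2 + (j.+2%:R ^+ 2) ^- 2).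

Lemma count_equality n a b :
  #|[set T in AST n.+1 | (mu_nabla T == a) && (#|SW T| + #|NE T| == b)%N]| =
  #|[set A in ASM n.+1 | (mu_ASM A == a) && (2 * #|swM A| == b)%N]|.
Proof.
apply: (@card_from_generating algC _ _ _ _ _ _ _ _ be ga2) => [i j /eqP|k i j|k j].
- by rewrite /be eqr_nat => /eqP[].
- have bek : be k != 0 by rewrite pnatr_eq0.
  have nz (l : nat) : l.+2%:R != 0 :> algC by rewrite pnatr_eq0.
  move=> /addrI /(mulfI bek).
  (* x + 1/x = y + 1/y means x = y or x y = 1, and the latter is impossible for x, y > 1. *)
  set x := (i.+2%:R ^+ 2) ^+ 2; set y := (j.+2%:R ^+ 2) ^+ 2 => E.
  have x0 : x != 0 by rewrite !expf_neq0.
  have y0 : y != 0 by rewrite !expf_neq0.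
  have : (x - y) * (x * y - 1) = 0.
    have -> : (x - y) * (x * y - 1) = x * y * ((x + x^-1) - (y + y^-1)) by field; rewrite x0 y0.
    by rewrite E subrr mulr0.
  move/eqP; rewrite mulf_eq0 !subr_eq0 /x /y -!exprM -!natrX -natrM eqr_nat (eqr_nat _ _ 1%N).
  have big1 l : (1 < l.+2 ^ (2 * 2))%N by rewrite -[1%N](exp1n (2 * 2)) ltn_exp2r.
  by rewrite eqn_exp2r // muln_eq1 (gtn_eqF (big1 i)) orbF => /eqP[].
- exact: homogeneous_equality.
Qed.
End Counting.

Theorem theorem5p5 (n : nat) (hn : (0 < n)%N) (m i : int) :
  #|[set A in ASM n | ((mu_ASM A)%:Z == m) && (inv_ASM A == i)]| =
  #|[set T in AST n | ((mu_nabla T)%:Z == m) && (inv_nabla T == i%:~R)]|.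
Proof.
case: n hn => // n _.
have EA (A : 'M[entry]_n.+1) : A \in ASM n.+1 -> (inv_ASM A == i) = ((2 * #|swM A|)%:Z == 2 * i).
  by rewrite inE is_ASME => /andP[ok _]; rewrite inv_ASME // PoszM (inj_eq (mulfI _)).
have ET (T : triangle n.+1) : (inv_nabla T == i%:~R) = ((#|SW T| + #|NE T|)%:Z == 2 * i).
  have two : (2%:R : rat) != 0 by [].
  rewrite /inv_nabla -(inj_eq (mulIf two)) divfK // -(eqr_int rat) intrM mulrC.
  by rewrite -pmulrn.
have -> : [set A in ASM n.+1 | ((mu_ASM A)%:Z == m) && (inv_ASM A == i)] =
          [set A in ASM n.+1 | ((mu_ASM A)%:Z == m) && ((2 * #|swM A|)%:Z == 2 * i)].
  by apply/setP => A; rewrite !inE; case: (boolP (is_ASM A)) => //= okA; rewrite EA // inE.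
have -> : [set T in AST n.+1 | ((mu_nabla T)%:Z == m) && (inv_nabla T == i%:~R)] =
          [set T in AST n.+1 | ((mu_nabla T)%:Z == m) && ((#|SW T| + #|NE T|)%:Z == 2 * i)].
  by apply/setP => T; rewrite !inE ET.
(* For negative [m] or [i] both sets are empty, the statistics being cardinalities. *)
have neg (j k : nat) : (k%:Z == 2 * Negz j) = false by lia.
case: m => [m|m]; last first.
  by rewrite !eq_card0 // => x; rewrite !inE andbF.
case: i {EA ET} => [i|i]; last first.
  by rewrite !eq_card0 // => x; rewrite !inE neg !andbF.
exact/esym/(count_equality n m (2 * i)).
Qed.
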